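(* The following two formulas define Poisson brackets on $C^\infty(\mathfrak M,\mathbb R)$: for $F,H\in C^\infty(\mathfrak M,\mathbb R)$, with all derivatives evaluated at $(g,J)$, $$\{F,H\}_1(g,J)=\langle \nabla_1F,d_2H\rangle-\langle\nabla_1H,d_2F\rangle+\langle J,[d_2F,d_2H]\rangle,$$ $$\{F,H\}_2(g,J)=\langle r\nabla_1F,\nabla_1H\rangle-\langle r\nabla_1'F,\nabla_1'H\rangle+\langle \nabla_2F-\nabla_2'F,\ r_+\nabla_2'H-r_-\nabla_2H\rangle+\langle\nabla_1F,\ r_+\nabla_2'H-r_-\nabla_2H\rangle-\langle\nabla_1H,\ r_+\nabla_2'F-r_-\nabla_2F\rangle.$$
   Context: $G=\mathrm{GL}(n,\mathbb C)$ is regarded as a real Lie group with Lie algebra $\mathcal G=\mathfrak{gl}(n,\mathbb C)$ regarded as a real Lie algebra, equipped with the bilinear form $\langle X,Y\rangle=\Re\operatorname{tr}(XY)$. Every $X\in\mathcal G$ decomposes uniquely as $X=X_>+X_0+X_<$ (strictly upper triangular, diagonal, strictly lower triangular parts). Set $r(X)=\frac12(X_>-X_<)$, $r_\pm=r\pm\frac12\mathrm{id}$, and write $rX$ for $r(X)$. Let $\mathfrak M=G\times\mathcal G=\{(g,J)\}$. For $F\in C^\infty(\mathfrak M,\mathbb R)$ define $\mathcal G$-valued derivatives by $\langle\nabla_1F(g,J),X\rangle=\frac{d}{dt}\big|_{t=0}F(e^{tX}g,J)$, $\langle\nabla_1'F(g,J),X\rangle=\frac{d}{dt}\big|_{t=0}F(ge^{tX},J)$,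 $\langle d_2F(g,J),X\rangle=\frac{d}{dt}\big|_{t=0}F(g,J+tX)$ for all $X\in\mathcal G$ ($t$ real), and $\nabla_2F(g,J)=J\,d_2F(g,J)$, $\nabla_2'F(g,J)=d_2F(g,J)\,J$. *)

(* Defs.v *)
From HB Require Import structures.
From mathcomp Require Import all_boot all_order all_algebra.
From mathcomp Require Import all_classical all_reals all_analysis.
From mathcomp Require Import complex.
Set Implicit Arguments. Unset Strict Implicit. Unset Printing Implicit Defensive.
Import Order.TTheory GRing.Theory Num.Theory.
Import numFieldNormedType.Exports.
Local Open Scope ring_scope.

Section Defs.
Variables (R : realType) (n : nat).

Definition Mat := 'M[R[i]]_n.
(* the ambient space G x gl(n,C) (points (g,J)); G is the open subset det g <> 0 *)
Definition Pt := (Mat * Mat)%type.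
Definition inM (p : Pt) : Prop := \det p.1 != 0.

Definition rsc (t : R) (X : Mat) : Mat := (t%:C)%C *: X.

Definition ip (X Y : Mat) : R := complex.Re (\tr (X *m Y)).

(* the "Riesz representative" of a real-linear functional L on gl(n,C) w.r.t.
   <.,.>: the unique A with <A,X> = L X for all X.  Explicitly
   A_ij = L(E_ji) - i L(i E_ji). *)
Definition riesz (L : Mat -> R) : Mat :=
  \matrix_(i < n, j < n) (Complex (L (delta_mx j i)) (- L (('i)%C *: delta_mx j i))).

Definition ddir (F : Pt -> R) (p : Pt) (v : Pt) : R :=
  derive1 (fun t : R => F (p.1 + rsc t v.1, p.2 + rsc t v.2)) 0.

Fixpoint iterD (F : Pt -> R) (vs : seq Pt) : Pt -> R :=
  match vs with
  | [::] => F
  | v :: vs' => fun p => ddir (iterD F vs') p v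
  end.

Definition mdist (X Y : Mat) : R :=
  \sum_(i < n) \sum_(j < n)
     (`|complex.Re (X i j - Y i j)| + `|complex.Im (X i j - Y i j)|).
Definition pdist (p q : Pt) : R := mdist p.1 q.1 + mdist p.2 q.2.

Definition cont_on_M (f : Pt -> R) : Prop :=
  forall p, inM p -> forall e : R, 0 < e -> exists2 d : R, 0 < d &
    forall q, inM q -> pdist q p < d -> `|f q - f p| < e.

Definition smooth (F : Pt -> R) : Prop :=
  (forall vs v p, inM p ->
     derivable (fun t : R => iterD F vs (p.1 + rsc t v.1, p.2 + rsc t v.2)) 0 1)
  /\ (forall vs, cont_on_M (iterD F vs)).

(* <nabla_1 F, X> = d/dt F(e^{tX} g, J) = directional derivative along (Xg, 0) *)
Definition nabla1 (F : Pt -> R) (p : Pt) : Mat :=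
  riesz (fun X => ddir F p (X *m p.1, 0)).
(* <nabla_1' F, X> = d/dt F(g e^{tX}, J) = directional derivative along (gX, 0) *)
Definition nabla1' (F : Pt -> R) (p : Pt) : Mat :=
  riesz (fun X => ddir F p (p.1 *m X, 0)).
Definition d2 (F : Pt -> R) (p : Pt) : Mat :=
  riesz (fun X => ddir F p (0, X)).
Definition nabla2 (F : Pt -> R) (p : Pt) : Mat := p.2 *m d2 F p.
Definition nabla2' (F : Pt -> R) (p : Pt) : Mat := d2 F p *m p.2.

Definition upper (X : Mat) : Mat := \matrix_(i, j) if (i < j)%N then X i j else 0.
Definition lower (X : Mat) : Mat := \matrix_(i, j) if (j < i)%N then X i j else 0.
Definition rr (X : Mat) : Mat := rsc (2^-1) (upper X - lower X).
Definition rplus (X : Mat) : Mat := rr X + rsc (2^-1) X.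
Definition rminus (X : Mat) : Mat := rr X - rsc (2^-1) X.

Definition bracket1 (F H : Pt -> R) : Pt -> R := fun p =>
  ip (nabla1 F p) (d2 H p) - ip (nabla1 H p) (d2 F p)
  + ip p.2 (d2 F p *m d2 H p - d2 H p *m d2 F p).

Definition bracket2 (F H : Pt -> R) : Pt -> R := fun p =>
  ip (rr (nabla1 F p)) (nabla1 H p) - ip (rr (nabla1' F p)) (nabla1' H p)
  + ip (nabla2 F p - nabla2' F p) (rplus (nabla2' H p) - rminus (nabla2 H p))
  + ip (nabla1 F p) (rplus (nabla2' H p) - rminus (nabla2 H p))
  - ip (nabla1 H p) (rplus (nabla2' F p) - rminus (nabla2 F p)).

Definition poisson_bracket (B : (Pt -> R) -> (Pt -> R) -> (Pt -> R)) : Prop :=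
  [/\ (forall F H, smooth F -> smooth H -> smooth (B F H)),
      (forall (a b : R) F G H, smooth F -> smooth G -> smooth H ->
         forall p, inM p ->
           B (fun q => a * F q + b * G q) H p = a * B F H p + b * B G H p),
      (forall F H, smooth F -> smooth H -> forall p, inM p -> B F H p = - B H F p),
      (forall F G H, smooth F -> smooth G -> smooth H -> forall p, inM p ->
         B F (fun q => G q * H q) p = B F G p * H p + G p * B F H p)
    & (forall F G H, smooth F -> smooth G -> smooth H -> forall p, inM p ->
         B F (B G H) p + B G (B H F) p + B H (B F G) p = 0)].

End Defs.

(* Main.v *)
Require Import Defs.
From mathcomp Require Import all_boot all_order all_algebra.
From mathcomp Require Import all_classical all_reals all_analysis.
From mathcomp Require Import complex ring lra zify.

(** Both brackets have the form {F, H}(p) = Pi_p(dF, dH) with Pi_p an antisymmetric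
    bivector polynomial in p, so everything except the Jacobi identity is calculus; by
    symmetry of second derivatives the Jacobi identity is that of Pi on constant
    covectors.  For the first bracket this is the Jacobi identity of gl(n,C).  For the
    second one, Pi_p(dF, dH) = <nablas F, rho (nablas H)> where nablas F collects the
    four derivatives (nabla_1, nabla_1', nabla_2, nabla_2'), which are derivatives along
    the left and right translations of g and J, and rho is a constant antisymmetric
    operator on gl(n,C)^4.  The modified classical Yang-Baxter equation for r gives the
    Schouten bracket of rho as a combination of the invariant forms <x, [y, z]> on the
    four factors, and on translation derivatives the left and right contributions of
    g, and likewise of J, are equal and cancel. *)

Set Implicit Arguments. Unset Strict Implicit. Unset Printing Implicit Defensive.
Import Order.TTheory GRing.Theory Num.Theory.
Import numFieldNormedType.Exports.
Local Open Scope ring_scope.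

(** * Calculus in two real variables *)

Section TwoVariables.
Variable R : realType.
Implicit Types (g : R -> R -> R) (f : R -> R).

(** Merges the mean value theorem for positive and negative [h] with the trivial case [h = 0]; the
    bound on [c] is what the later limits use. *)
Lemma MVT_between f df (d : R) :
  (forall s, `|s| < d -> is_derive s (1 : R) f (df s)) ->
  forall h, `|h| < d -> exists2 c, `|c| <= `|h| & f h - f 0 = h * df c.
Proof.
move=> fd h hd.
have cont a b : `|a| < d -> `|b| < d -> {within `[a, b], continuous f}%classic.
  move=> ad bd; apply: derivable_within_continuous => x; rewrite in_itv /= => /andP[ax xb].
  have xd : `|x| < d by move: ad bd; rewrite !ltr_norml; lra.
  by have [] := fd x xd.
have [h0|h0|->] := ltgtP h 0; last by exists 0; rewrite // subrr mul0r.
- have d0 : `|0 : R| < d by rewrite normr0 (le_lt_trans _ hd).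
  have fd' x : x \in `]h, 0[ -> is_derive x (1 : R) f (df x).
    rewrite in_itv /= => /andP[ax xb]; apply: fd; move: hd; rewrite !ltr_norml; lra.
  have [c] := MVT h0 fd' (cont _ _ hd d0).
  rewrite in_itv /= => /andP[hc c0] e; exists c.
    by rewrite !ler0_norm; lra.
  by lra.
- have d0 : `|0 : R| < d by rewrite normr0 (le_lt_trans _ hd).
  have fd' x : x \in `]0, h[ -> is_derive x (1 : R) f (df x).
    rewrite in_itv /= => /andP[ax xb]; apply: fd; move: hd; rewrite !ltr_norml; lra.
  have [c] := MVT h0 fd' (cont _ _ d0 hd).
  rewrite in_itv /= => /andP[hc c0] e; exists c.
    by rewrite !ger0_norm; lra.
  by lra.
Qed.

Definition cont2 g := forall e : R, 0 < e -> exists2 d : R, 0 < d &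
  forall s t, `|s| < d -> `|t| < d -> `|g s t - g 0 0| < e.

(** The mean value theorem applies first to the difference of g(., h) and g(., 0), then to the
    resulting [gs s] in its second variable. *)
Lemma second_difference g gs gst (d h : R) :
  (forall s t, `|s| < d -> `|t| < d -> is_derive s (1 : R) (g ^~ t) (gs s t)) ->
  (forall s t, `|s| < d -> `|t| < d -> is_derive t (1 : R) (gs s) (gst s t)) ->
  `|h| < d ->
  exists s t, [/\ `|s| <= `|h|, `|t| <= `|h| &
    g h h - g 0 h - (g h 0 - g 0 0) = h * (h * gst s t)].
Proof.
move=> gs_ gst_ hd.
have d0 : `|0 : R| < d by rewrite normr0 (le_lt_trans _ hd).
have D s : `|s| < d ->
    is_derive s (1 : R) (fun s => g s h - g s 0) (gs s h - gs s 0).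
  by move=> sd; apply: is_deriveB; apply: gs_.
have [s sh es] := MVT_between D hd.
have sd := le_lt_trans sh hd.
have [t th et] := MVT_between (fun t => gst_ s t sd) hd.
by exists s, t; split => //; rewrite -et -es; lra.
Qed.

(** Both orders of differentiation compute the same second difference over a square of side [h];
    dividing by the area and shrinking the square identifies the mixed derivatives. *)
Lemma schwarz2 g gs gt gst gts (d : R) : 0 < d ->
  (forall s t, `|s| < d -> `|t| < d -> is_derive s (1 : R) (g ^~ t) (gs s t)) ->
  (forall s t, `|s| < d -> `|t| < d -> is_derive t (1 : R) (g s) (gt s t)) ->
  (forall s t, `|s| < d -> `|t| < d -> is_derive t (1 : R) (gs s) (gst s t)) ->
  (forall s t, `|s| < d -> `|t| < d -> is_derive s (1 : R) (gt ^~ t) (gts s t)) ->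
  cont2 gst -> cont2 gts -> gst 0 0 = gts 0 0.
Proof.
move=> d0 gs_ gt_ gst_ gts_ c1 c2; apply/eqP; rewrite -subr_eq0 -normr_eq0.
apply/negPn/negP => ne.
set e := `|gst 0 0 - gts 0 0| in ne.
have e0 : 0 < e by rewrite lt_def ne /e normr_ge0.
have [d1 d10 {}c1] := c1 (e / 2) ltac:(lra).
have [d2 d20 {}c2] := c2 (e / 2) ltac:(lra).
(* Half the least radius keeps the square where all derivatives exist and both mixed ones are within
   [e / 2] of their values at the origin. *)
pose h := Num.min d (Num.min d1 d2) / 2.
have h0 : 0 < h by rewrite divr_gt0 // !lt_min d0 d10 d20.
have hd : `|h| < Num.min d (Num.min d1 d2).
  have m0 : 0 < Num.min d (Num.min d1 d2) by rewrite !lt_min d0 d10 d20.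
  rewrite gtr0_norm // /h; lra.
move: hd; rewrite !lt_min => /and3P[hd hd1 hd2].
(* The second difference is symmetric in the two variables, so the lemma is used for [g] and for [g]
   with its arguments exchanged. *)
have [s [t [sh th e1]]] := second_difference gs_ gst_ hd.
have [t' [s' [th' sh' e2]]] := second_difference (g := fun t s => g s t)
  (fun t s td sd => gt_ s t sd td) (fun t s td sd => gts_ s t sd td) hd.
have eqg : gst s t = gts s' t'.
  apply: (mulfI (lt0r_neq0 h0)); apply: (mulfI (lt0r_neq0 h0)).
  by rewrite -e1 -e2; lra.
have := c1 s t (le_lt_trans sh hd1) (le_lt_trans th hd1).
have := c2 s' t' (le_lt_trans sh' hd2) (le_lt_trans th' hd2).
rewrite eqg => l1 l2.
have : e < e.
  rewrite {1}/e.
  have -> : gst 0 0 - gts 0 0 = (gts s' t' - gts 0 0) - (gts s' t' - gst 0 0) by lra.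
  by apply: (le_lt_trans (ler_normB _ _)); lra.
by rewrite ltxx.
Qed.

(** The increment along the diagonal splits into a step in the first variable, controlled by the
    mean value theorem and continuity of [gs], and the increment of [g 0]. Additivity of directional
    derivatives rests on this. *)
Lemma is_derive_diag g gs (l d : R) : 0 < d ->
  (forall s t, `|s| < d -> `|t| < d -> is_derive s (1 : R) (g ^~ t) (gs s t)) ->
  is_derive (0 : R) (1 : R) (g 0) l -> cont2 gs ->
  is_derive (0 : R) (1 : R) (fun h => g h h) (gs 0 0 + l).
Proof.
move=> d0 gs_ g0 cgs.
suff k : is_derive (0 : R) (1 : R) (fun h => g h h - g 0 h) (gs 0 0).
  have -> : (fun h => g h h) = (fun h => g h h - g 0 h) + g 0.
    by apply/funext => h; rewrite !fctE subrK.
  exact: is_deriveD.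
set k := fun h => _.
have cv : (h^-1 *: (k (h *: (1 : R) + (0 : R)) - k 0) @[h --> (0 : R)^'] --> (gs 0 0 : R))%classic.
  apply/cvgrPdist_lt => e e0; have [d1 d10 {}cgs] := cgs e e0.
  near=> h.
  have hd : `|h| < d by near: h; apply: dnbhs0_lt.
  have hd1 : `|h| < d1 by near: h; apply: dnbhs0_lt.
  have h0 : h != 0 by near: h; exact: nbhs_dnbhs_neq.
  rewrite /k addr0 subrr subr0 /GRing.scale /= mulr1.
  have [s sh ->] := MVT_between (fun s sd => gs_ s h sd hd) hd.
  rewrite mulKf // distrC; apply: cgs => //; exact: le_lt_trans sh hd1.
split; first by apply/cvg_ex; exists (gs 0 0).
exact: cvg_lim.
Unshelve. all: by end_near.
Qed.
End TwoVariables.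

(** * Real and imaginary parts of complex arithmetic *)

Section ComplexParts.
Variable R : realType.
Implicit Types (x y : R[i]) (a : R).

Lemma ReD x y : complex.Re (x + y) = complex.Re x + complex.Re y.
Proof. by case: x; case: y. Qed.
Lemma ImD x y : complex.Im (x + y) = complex.Im x + complex.Im y.
Proof. by case: x; case: y. Qed.
Lemma ReN x : complex.Re (- x) = - complex.Re x. Proof. by case: x. Qed.
Lemma ImN x : complex.Im (- x) = - complex.Im x. Proof. by case: x. Qed.
Lemma ReM x y : complex.Re (x * y)
  = complex.Re x * complex.Re y - complex.Im x * complex.Im y.
Proof. by case: x; case: y. Qed.
Lemma ImM x y : complex.Im (x * y)
  = complex.Re x * complex.Im y + complex.Im x * complex.Re y.
Proof. by case: x => a b; case: y. Qed.
Lemma ReZ a x : complex.Re ((a%:C)%C * x) = a * complex.Re x.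
Proof. by rewrite ReM /= mul0r subr0. Qed.
Lemma ImZ a x : complex.Im ((a%:C)%C * x) = a * complex.Im x.
Proof. by rewrite ImM /= mul0r addr0. Qed.
Lemma complex_eq x y :
  complex.Re x = complex.Re y -> complex.Im x = complex.Im y -> x = y.
Proof. by case: x => a b; case: y => c d /= -> ->. Qed.
Lemma Re_sum I (r : seq I) (P : pred I) (F : I -> R[i]) :
  complex.Re (\sum_(i <- r | P i) F i) = \sum_(i <- r | P i) complex.Re (F i).
Proof. exact: (big_morph _ ReD). Qed.
Lemma Im_sum I (r : seq I) (P : pred I) (F : I -> R[i]) :
  complex.Im (\sum_(i <- r | P i) F i) = \sum_(i <- r | P i) complex.Im (F i).
Proof. exact: (big_morph _ ImD). Qed.
End ComplexParts.

(** * Straight lines in the space of pairs, and continuity with respect to [pdist] *)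

Section Lines.
Variables (R : realType) (n : nat).
Local Notation Pt := (@Defs.Pt R n).
Local Notation Mat := (@Defs.Mat R n).
Local Notation mdist := (@Defs.mdist R n).
Implicit Types (p q v w : Pt) (s t : R) (X Y : Mat).

Lemma rscD X Y t : rsc t (X + Y) = rsc t X + rsc t Y.
Proof. exact: scalerDr. Qed.
Lemma rscDl X s t : rsc (s + t) X = rsc s X + rsc t X.
Proof. by rewrite /rsc rmorphD scalerDl. Qed.
Lemma rsc0 X : rsc 0 X = 0.
Proof. by rewrite /rsc rmorph0 scale0r. Qed.
Lemma rscA X s t : rsc s (rsc t X) = rsc (s * t) X.
Proof. by rewrite /rsc scalerA rmorphM. Qed.

Definition line p v t : Pt := (p.1 + rsc t v.1, p.2 + rsc t v.2).

Lemma line0 p v : line p v 0 = p.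
Proof. by case: p => g J; rewrite /line !rsc0 !addr0. Qed.
Lemma line_line p v s t : line (line p v s) v t = line p v (s + t).
Proof. by rewrite /line /= !rscDl !addrA. Qed.
Lemma line_swap p v w s t : line (line p v s) w t = line (line p w t) v s.
Proof. by rewrite /line /= -!addrA ![rsc s _ + _]addrC. Qed.
Lemma line_diag p v w t : line (line p v t) w t = line p (v + w) t.
Proof. by rewrite /line /= !rscD !addrA. Qed.
Lemma line_scale p v s t : line p (rsc s v.1, rsc s v.2) t = line p v (s * t).
Proof. by rewrite /line /= !rscA mulrC. Qed.

Lemma mdist_line X Y V t : mdist (X + rsc t V) Y <= mdist X Y + `|t| * mdist V 0.
Proof.
rewrite /Defs.mdist mulr_sumr -big_split /=; apply: ler_sum => i _.
rewrite mulr_sumr -big_split /=; apply: ler_sum => j _.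
rewrite !mxE !ReD !ImD !ReN !ImN ReZ ImZ !subr0 /=.
have E (a b c : R) : a + t * b - c = (a - c) + t * b by lra.
rewrite !E.
set a := _ - _; set b := _ - _; set c := complex.Re _; set d := complex.Im _.
by have := ler_normD a (t * c); have := ler_normD b (t * d); rewrite !normrM; lra.
Qed.

Definition psize v := mdist v.1 0 + mdist v.2 0.

Lemma mdist_ge0 X Y : 0 <= mdist X Y.
Proof. by apply: sumr_ge0 => i _; apply: sumr_ge0 => j _; rewrite addr_ge0. Qed.
Lemma psize_ge0 v : 0 <= psize v.
Proof. by rewrite addr_ge0 // mdist_ge0. Qed.
Lemma pdistxx p : pdist p p = 0.
Proof.
rewrite /pdist /Defs.mdist !big1 ?addr0 // => i _; rewrite big1 // => j _;
  by rewrite subrr /= normr0 addr0.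
Qed.
Lemma pdist_line p q v t : pdist (line p v t) q <= pdist p q + `|t| * psize v.
Proof.
rewrite /pdist /psize /=.
by have := mdist_line p.1 q.1 v.1 t; have := mdist_line p.2 q.2 v.2 t; lra.
Qed.

Lemma plane_near p v w (d : R) : 0 < d -> exists2 e : R, 0 < e &
  forall s t, `|s| < e -> `|t| < e -> pdist (line (line p v s) w t) p < d.
Proof.
(* The summand 1 keeps [N] positive when both directions vanish. *)
move=> d0; set N := psize v + psize w + 1.
have N0 : 0 < N by have := psize_ge0 v; have := psize_ge0 w; rewrite /N; lra.
exists (d / N); first exact: divr_gt0.
move=> s t sd td.
apply: le_lt_trans (pdist_line _ _ _ _) _.
apply: le_lt_trans (_ : _ <= `|s| * psize v + `|t| * psize w) _.
  by have := pdist_line p p v s; rewrite pdistxx; lra.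
have dN : d = d / N * N by rewrite divfK // lt0r_neq0.
have a1 : `|s| * psize v <= d / N * psize v by rewrite ler_wpM2r // ?psize_ge0 // ltW.
have a2 : `|t| * psize w <= d / N * psize w by rewrite ler_wpM2r // ?psize_ge0 // ltW.
have dN0 : 0 < d / N by exact: divr_gt0.
by rewrite [ltRHS]dN /N; lra.
Qed.

(** The filter of [pdist] balls around [p]; phrased through it, continuity on M inherits the algebra
    of limits. *)
Definition nb p : set_system Pt :=
  filter_from [set d : R | 0 < d]%classic (fun d => [set q | pdist q p < d]%classic).

#[global] Instance nb_filter p : Filter (nb p).
Proof.
apply: filter_from_filter; first by exists 1; rewrite /= ltr01.
move=> a b /= a0 b0; exists (Num.min a b); first by rewrite /= lt_min a0.
by move=> q /=; rewrite lt_min => /andP[].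
Qed.

Lemma nb_plane p v w (A : set Pt) : nb p A -> exists2 e : R, 0 < e &
  forall s t, `|s| < e -> `|t| < e -> A (line (line p v s) w t).
Proof.
move=> [d /= d0 dA]; have [e e0 eA] := plane_near p v w d0.
by exists e => // s t se te; apply: dA; apply: eA.
Qed.

Lemma nb_line p v (A : set Pt) : nb p A -> (\forall t \near (0 : R), A (line p v t))%classic.
Proof.
move=> /(nb_plane v v)[e e0 eA].
apply: filterS (nbhsx_ballx (0 : R) e e0) => t.
rewrite /ball /= sub0r normrN => te.
by rewrite -(line0 (line p v t) v); apply: eA; rewrite ?normr0.
Qed.

Definition ccont (f : Pt -> R[i]) p :=
  ((complex.Re (f q) @[q --> nb p] --> complex.Re (f p)) /\
   (complex.Im (f q) @[q --> nb p] --> complex.Im (f p)))%classic.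

Lemma ccont_cst (c : R[i]) p : ccont (fun=> c) p.
Proof. by split; exact: cvg_cst. Qed.

Lemma ccontD f g p : ccont f p -> ccont g p -> ccont (fun q => f q + g q) p.
Proof.
move=> [f1 f2] [g1 g2]; split; under eq_fun do rewrite ?ReD ?ImD.
  by rewrite ReD; exact: cvgD.
by rewrite ImD; exact: cvgD.
Qed.

Lemma ccontM f g p : ccont f p -> ccont g p -> ccont (fun q => f q * g q) p.
Proof.
move=> [f1 f2] [g1 g2]; split; under eq_fun do rewrite ?ReM ?ImM.
  by rewrite ReM; apply: cvgB; exact: cvgM.
by rewrite ImM; apply: cvgD; exact: cvgM.
Qed.

(** The operation is arbitrary because the Leibniz formula for the determinant uses both sums and
    products. *)
Lemma ccont_big (op : R[i] -> R[i] -> R[i]) (idx : R[i]) I (r : seq I) (P : pred I)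
    (F : I -> Pt -> R[i]) p :
  (forall f g, ccont f p -> ccont g p -> ccont (fun q => op (f q) (g q)) p) ->
  (forall i, ccont (F i) p) ->
  ccont (fun q => \big[op/idx]_(i <- r | P i) F i q) p.
Proof.
move=> opc Fc; elim: r => [|i r IH].
  by under eq_fun do rewrite big_nil; exact: ccont_cst.
under eq_fun do rewrite big_cons.
by case: (P i) => //; apply: opc.
Qed.

Lemma entry_dist X Y i j :
  `|complex.Re (X i j) - complex.Re (Y i j)| <= mdist X Y /\
  `|complex.Im (X i j) - complex.Im (Y i j)| <= mdist X Y.
Proof.
have : `|complex.Re (X i j - Y i j)| + `|complex.Im (X i j - Y i j)| <= mdist X Y.
  rewrite /Defs.mdist (bigD1 i) //= (bigD1 j) //= -addrA lerDl addr_ge0 //;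
    apply: sumr_ge0 => k _; first by rewrite addr_ge0.
  by apply: sumr_ge0 => l _; rewrite addr_ge0.
rewrite ReD ImD ReN ImN.
by move=> le; split; apply: le_trans le; rewrite ?lerDl ?lerDr.
Qed.

Lemma ccont_entry1 i j p : ccont (fun q => q.1 i j) p.
Proof.
split; apply/cvgrPdist_lt => e e0; exists e => // q qe /=;
have [a b] := entry_dist q.1 p.1 i j; rewrite distrC; move: qe; rewrite /= /pdist;
by have := mdist_ge0 q.2 p.2; lra.
Qed.

Lemma ccont_entry2 i j p : ccont (fun q => q.2 i j) p.
Proof.
split; apply/cvgrPdist_lt => e e0; exists e => // q qe /=;
have [a b] := entry_dist q.2 p.2 i j; rewrite distrC; move: qe; rewrite /= /pdist;
by have := mdist_ge0 q.1 p.1; lra.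
Qed.

(** The determinant is a polynomial in the entries, hence continuous; where it is nonzero, its real
    or its imaginary part stays nonzero nearby. *)
Lemma inM_open p : inM p -> nb p (@inM R n).
Proof.
move=> pM.
have [c1 c2] : ccont (fun q => \det q.1) p.
  apply: ccont_big; first by move=> f g; exact: ccontD.
  move=> s; apply: ccontM; first exact: ccont_cst.
  apply: ccont_big; first by move=> f g; exact: ccontM.
  by move=> i; exact: ccont_entry1.
have [r0|r0] := eqVneq (complex.Re (\det p.1)) 0.
  have i0 : complex.Im (\det p.1) != 0.
    by apply: contra_neq pM => i0; exact: complex_eq.
  have /(_ (nb_filter p) i0) := cvgr_neq0 _ c2; apply: filterS => q; rewrite /inM.
  by apply: contra_neq => ->.
have /(_ (nb_filter p) r0) := cvgr_neq0 _ c1; apply: filterS => q; rewrite /inM.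
by apply: contra_neq => ->.
Qed.

(** Openness of M absorbs the restriction to points of M in [cont_on_M]. *)
Lemma cont_on_MP (f : Pt -> R) :
  cont_on_M f <-> forall p, inM p -> (f q @[q --> nb p] --> f p)%classic.
Proof.
split=> cf p pM.
  apply/cvgrPdist_lt => e e0; have [d d0 df] := cf p pM e e0.
  have dn : nb p [set q | pdist q p < d]%classic by exists d.
  apply: filterS2 (inM_open pM) dn => q qM /= qd.
  by rewrite distrC; exact: df.
move=> e e0; have /cvgrPdist_lt/(_ e e0)[d /= d0 df] := cf p pM.
by exists d => // q qM qd; rewrite distrC; exact: df.
Qed.
End Lines.

(** * Directional derivatives and smooth functions on G x gl(n,C) *)

Section Smooth.
Variables (R : realType) (n : nat).
Local Notation Pt := (@Defs.Pt R n).
Local Notation Mat := (@Defs.Mat R n).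
Local Notation iterD := (@Defs.iterD R n).
Implicit Types (p q v w : Pt) (s t : R) (X Y : Mat) (F G H : Pt -> R).

Definition hasD F p v l := is_derive (0 : R) (1 : R) (fun t => F (line p v t)) l.

Lemma hasD_ddir F p v l : hasD F p v l -> ddir F p v = l.
Proof. by move=> [_ <-]; rewrite /ddir derive1E. Qed.

Lemma hasD_eq F p v l l' : hasD F p v l -> l = l' -> hasD F p v l'.
Proof. by move=> h <-. Qed.

Lemma is_derive_at0 (f : R -> R) s l :
  is_derive (0 : R) (1 : R) (fun t => f (s + t)) l -> is_derive s (1 : R) f l.
Proof.
have E : (fun h : R => h^-1 *: ((f \o shift s) (h *: (1 : R)) - f s)) =
   (fun h : R => h^-1 *: (((fun t => f (s + t)) \o shift 0) (h *: (1 : R)) - f (s + 0))).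
  by apply/funext => h /=; rewrite !addr0 [s + _]addrC.
by move=> [d e]; split; rewrite /derivable ?/derive E.
Qed.

Lemma hasD_at F p v s l : hasD F (line p v s) v l ->
  is_derive s (1 : R) (fun t => F (line p v t)) l.
Proof.
move=> h; apply: is_derive_at0; move: h; rewrite /hasD.
by under eq_fun do rewrite line_line.
Qed.

Lemma hasD_congr F G p v l : (forall q, inM q -> F q = G q) -> inM p ->
  hasD F p v l -> hasD G p v l.
Proof.
move=> FG pM; apply: near_eq_is_derive.
by apply: filterS (nb_line v (inM_open pM)) => t; exact: FG.
Qed.

Lemma hasD_cst (c : R) p v : hasD ((fun=> c) : Pt -> R) p v 0.
Proof. exact: is_derive_cst. Qed.
Lemma hasDD F G p v a b : hasD F p v a -> hasD G p v b ->
  hasD (fun q => F q + G q) p v (a + b).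
Proof. exact: is_deriveD. Qed.
Lemma hasDN F p v a : hasD F p v a -> hasD (fun q => - F q) p v (- a).
Proof. exact: is_deriveN. Qed.
Lemma hasDM F G p v a b : hasD F p v a -> hasD G p v b ->
  hasD (fun q => F q * G q) p v (a * G p + F p * b).
Proof.
move=> Fa Gb.
have := @is_deriveM _ _ (fun t => F (line p v t)) (fun t => G (line p v t)) 0 1 a b Fa Gb.
rewrite line0 /GRing.scale /= => h.
by apply: (is_derive_eq h); ring.
Qed.

Definition regular F vs :=
  (forall v p, inM p -> hasD (iterD F vs) p v (ddir (iterD F vs) p v)) /\
  cont_on_M (iterD F vs).

Lemma smoothE F : smooth F <-> forall vs, regular F vs.
Proof.
split=> [[dF cF] vs|rF].
  split; last exact: cF.
  move=> v p pM; split; first exact: dF.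
  by rewrite /ddir derive1E.
split; last by move=> vs; have [] := rF vs.
by move=> vs v p pM; have [/(_ v p pM)[]] := rF vs.
Qed.

(** M is open, so a short piece of any line through a point of M stays in M, and values outside M do
    not influence derivatives on M. *)
Lemma eq_iterD F G vs : (forall q, inM q -> F q = G q) ->
  forall q, inM q -> iterD F vs q = iterD G vs q.
Proof.
move=> FG; elim: vs => //= v vs IH q qM.
rewrite /ddir !derive1E; apply: near_eq_derive.
by apply: filterS (nb_line v (inM_open qM)) => t; exact: IH.
Qed.

Lemma eq_ddir F G v : (forall q, inM q -> F q = G q) ->
  forall q, inM q -> ddir F q v = ddir G q v.
Proof. by move=> FG; exact: (eq_iterD [:: v] FG). Qed.

Lemma eq_cont F G : (forall q, inM q -> F q = G q) -> cont_on_M F -> cont_on_M G.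
Proof.
move=> FG cF p pM e e0; have [d d0 dF] := cF p pM e e0.
by exists d => // q qM qd; rewrite -!FG //; exact: dF.
Qed.

Lemma eq_regular F G vs : (forall q, inM q -> F q = G q) -> regular F vs -> regular G vs.
Proof.
move=> FG [dF cF]; have E := eq_iterD vs FG; split; last exact: eq_cont cF.
move=> v p pM; rewrite -(eq_ddir v E pM).
exact: hasD_congr E pM (dF v p pM).
Qed.

Lemma eq_smooth F G : (forall q, inM q -> F q = G q) -> smooth F -> smooth G.
Proof. by move=> FG /smoothE rF; apply/smoothE => vs; exact: eq_regular (rF vs). Qed.

(** The last vector of the list is differentiated along first, so removing it replaces [F] by a
    first derivative and lowers the order by one. *)
Lemma iterD_rcons F vs v : iterD F (rcons vs v) = iterD (fun p => ddir F p v) vs.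
Proof. by elim: vs => //= w vs ->. Qed.

(** Smoothness filtered by order, so that closure under sums and products follows by induction on
    [k] over all functions at once. *)
Definition Ck k F := forall vs, (size vs <= k)%N -> regular F vs.

Lemma CkP F : smooth F <-> forall k, Ck k F.
Proof.
by split=> [/smoothE rF k vs _ //|cF]; apply/smoothE => vs; exact: (cF (size vs)).
Qed.

Lemma Ck0 F (F' : Pt -> Pt -> R) : cont_on_M F ->
  (forall v p, inM p -> hasD F p v (F' v p)) -> Ck 0 F.
Proof.
move=> cF dF [|w vs] vk; last by rewrite ltn0 in vk.
split; last exact: cF.
move=> v p pM.
by rewrite (hasD_ddir (dF v p pM)); exact: dF.
Qed.

(** An explicit formula [F'] for the first derivatives, valid on M, reduces order [k.+1] to order
    [k]. *)
Lemma CkS k F (F' : Pt -> Pt -> R) : cont_on_M F ->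
  (forall v p, inM p -> hasD F p v (F' v p)) ->
  (forall v, Ck k (F' v)) -> Ck k.+1 F.
Proof.
move=> cF dF cF' vs; case/lastP: vs => [_|vs v]; first exact: (Ck0 cF dF).
rewrite size_rcons ltnS => sk.
have E q : inM q -> F' v q = ddir F q v.
  by move=> qM; rewrite (hasD_ddir (dF v q qM)).
by have := eq_regular E (cF' v vs sk); rewrite /regular iterD_rcons.
Qed.

Lemma Ck_cont k F : Ck k F -> cont_on_M F.
Proof. by move=> /(_ [::] isT)[]. Qed.
Lemma Ck_hasD k F : Ck k F -> forall v p, inM p -> hasD F p v (ddir F p v).
Proof. by move=> /(_ [::] isT)[]. Qed.
Lemma Ck_ddir k F v : Ck k.+1 F -> Ck k (fun p => ddir F p v).
Proof.
move=> cF vs vk; have := cF (rcons vs v); rewrite size_rcons => /(_ vk).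
by rewrite /regular iterD_rcons.
Qed.
Lemma CkW k F : Ck k.+1 F -> Ck k F.
Proof. by move=> cF vs /leqW; exact: cF. Qed.

Lemma contD F G : cont_on_M F -> cont_on_M G -> cont_on_M (fun q => F q + G q).
Proof.
move=> /cont_on_MP cF /cont_on_MP cG; apply/cont_on_MP => p pM.
by apply: cvgD; [exact: cF|exact: cG].
Qed.
Lemma contM F G : cont_on_M F -> cont_on_M G -> cont_on_M (fun q => F q * G q).
Proof.
move=> /cont_on_MP cF /cont_on_MP cG; apply/cont_on_MP => p pM.
by apply: cvgM; [exact: cF|exact: cG].
Qed.

Lemma CkD k F G : Ck k F -> Ck k G -> Ck k (fun q => F q + G q).
Proof.
elim: k F G => [|k IH] F G cF cG.
  apply: (Ck0 (contD (Ck_cont cF) (Ck_cont cG))) => v p pM.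
  by apply: hasDD; [exact: Ck_hasD cF _ _ _|exact: Ck_hasD cG _ _ _].
apply: (CkS (contD (Ck_cont cF) (Ck_cont cG))) => [v p pM|v].
  by apply: hasDD; [exact: Ck_hasD cF _ _ _|exact: Ck_hasD cG _ _ _].
by apply: IH; exact: Ck_ddir.
Qed.

Lemma CkM k F G : Ck k F -> Ck k G -> Ck k (fun q => F q * G q).
Proof.
elim: k F G => [|k IH] F G cF cG.
  apply: (Ck0 (contM (Ck_cont cF) (Ck_cont cG))) => v p pM.
  by apply: hasDM; [exact: Ck_hasD cF _ _ _|exact: Ck_hasD cG _ _ _].
apply: (CkS (contM (Ck_cont cF) (Ck_cont cG))) => [v p pM|v].
  by apply: hasDM; [exact: Ck_hasD cF _ _ _|exact: Ck_hasD cG _ _ _].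
(* The derivative of a product is a sum of products whose factors are again of class [k]. *)
by apply: CkD; apply: IH; (try exact: Ck_ddir); exact: CkW.
Qed.

Lemma cont_cst (c : R) : cont_on_M ((fun=> c) : Pt -> R).
Proof. by apply/cont_on_MP => p pM; exact: cvg_cst. Qed.

Lemma Ck_cst k (c : R) : Ck k ((fun=> c) : Pt -> R).
Proof.
elim: k c => [|k IH] c; first exact: (Ck0 (cont_cst c) (fun v p _ => hasD_cst c p v)).
exact: (CkS (cont_cst c) (fun v p _ => hasD_cst c p v)).
Qed.

Lemma smooth_cst (c : R) : smooth ((fun=> c) : Pt -> R).
Proof. by apply/CkP => k; exact: Ck_cst. Qed.
Lemma smoothD F G : smooth F -> smooth G -> smooth (fun q => F q + G q).
Proof. by move=> /CkP cF /CkP cG; apply/CkP => k; exact: CkD. Qed.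
Lemma smoothM F G : smooth F -> smooth G -> smooth (fun q => F q * G q).
Proof. by move=> /CkP cF /CkP cG; apply/CkP => k; exact: CkM. Qed.
Lemma smoothN F : smooth F -> smooth (fun q => - F q).
Proof.
move=> sF; apply: eq_smooth (smoothM (smooth_cst (-1)) sF) => q _.
by rewrite mulN1r.
Qed.
Lemma smooth_ddir F v : smooth F -> smooth (fun q => ddir F q v).
Proof. by move=> /CkP cF; apply/CkP => k; exact: Ck_ddir (cF k.+1). Qed.
Lemma smooth_hasD F p v : smooth F -> inM p -> hasD F p v (ddir F p v).
Proof. by move=> /CkP/(_ 0%N) cF pM; exact: Ck_hasD cF _ _ _. Qed.

(** The derivative depends on the direction only, so higher derivatives are those of constants. *)
Lemma smooth_affine F (F' : Pt -> R) : cont_on_M F ->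
  (forall v p, hasD F p v (F' v)) -> smooth F.
Proof.
move=> cF dF; apply/CkP => -[|k]; first exact: (Ck0 cF (fun v p _ => dF v p)).
exact: (CkS (F' := fun v _ => F' v) cF (fun v p _ => dF v p) (fun v => @Ck_cst _ _)).
Qed.

Lemma hasD_affine F p v l : (forall t, F (line p v t) = F p + t * l) -> hasD F p v l.
Proof.
move=> E; rewrite /hasD; under eq_fun do rewrite E.
have := is_deriveD (is_derive_cst (F p) (0 : R) (1 : R))
  (is_deriveM (is_derive_id (0 : R) (1 : R)) (is_derive_cst l (0 : R) (1 : R))).
by move=> h; apply: (is_derive_eq h); rewrite add0r scaler0 add0r /GRing.scale /= mulr1.
Qed.

Lemma ddir_scale F p v s : smooth F -> inM p ->
  ddir F p (rsc s v.1, rsc s v.2) = s * ddir F p v.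
Proof.
move=> sF pM; apply: hasD_ddir; rewrite /hasD.
under eq_fun do rewrite line_scale.
rewrite mulrC; apply: (@is_derive1_comp _ (fun t => F (line p v t)) ( *%R s)).
  by rewrite mulr0; exact: smooth_hasD.
have := is_deriveZ s (is_derive_id (0 : R) (1 : R)).
by move=> h; apply: (is_derive_eq h); rewrite /GRing.scale /= mulr1.
Qed.

Lemma cont2_plane F p v w : cont_on_M F -> inM p ->
  cont2 (fun s t => F (line (line p v s) w t)).
Proof.
move=> /cont_on_MP/(_ p) cF pM e e0.
have /cvgrPdist_lt/(_ e e0) cFe := cF pM.
have [d d0 dF] := @nb_plane R n p v w [set q | `|F p - F q| < e]%classic cFe.
exists d; first exact: d0.
by move=> s t sd td; rewrite !line0 distrC; exact: (dF s t sd td).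
Qed.

Lemma plane_hasD F p v w : smooth F -> inM p -> exists2 d : R, 0 < d &
  (forall s t, `|s| < d -> `|t| < d ->
   is_derive s (1 : R) (fun s => F (line (line p v s) w t))
     (ddir F (line (line p v s) w t) v)) /\
  (forall s t, `|s| < d -> `|t| < d ->
   is_derive t (1 : R) (fun t => F (line (line p v s) w t))
     (ddir F (line (line p v s) w t) w)).
Proof.
move=> sF pM; have [d d0 dM] := nb_plane v w (inM_open pM).
exists d; first exact: d0.
split=> s t sd td; last by apply: hasD_at; apply: smooth_hasD sF (dM _ _ sd td).
(* Only the last displacement can be differentiated directly, so the two displacements are exchanged
   first. *)
have -> : (fun s => F (line (line p v s) w t)) = (fun s => F (line (line p w t) v s)).
  by apply/funext => s'; rewrite line_swap.
have := dM _ _ sd td; rewrite line_swap => ptM.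
by apply: hasD_at; exact: smooth_hasD sF ptM.
Qed.

(** [smooth] asks for differentiability along single lines; additivity comes from the diagonal of
    the plane through [p] in the directions [v] and [w], using continuity of the derivative along
    [v]. *)
Lemma ddirD F p v w : smooth F -> inM p ->
  ddir F p (v + w) = ddir F p v + ddir F p w.
Proof.
move=> sF pM; apply: hasD_ddir; rewrite /hasD.
under eq_fun do rewrite -line_diag.
have [d d0 [dv dw]] := plane_hasD v w sF pM.
have cv : cont_on_M (fun q => ddir F q v).
  by have /CkP/(_ 0%N)/Ck_cont := smooth_ddir v sF.
have g0 : is_derive (0 : R) (1 : R) (fun t => F (line (line p v 0) w t)) (ddir F p w).
  by rewrite line0; exact: smooth_hasD.
have := is_derive_diag (g := fun s t => F (line (line p v s) w t))
  (gs := fun s t => ddir F (line (line p v s) w t) v) d0 dv g0 (cont2_plane v w cv pM).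
by rewrite !line0.
Qed.

(** Schwarz's theorem in the parameters of the plane through [p] in the directions [v] and [w]. *)
Lemma hessian_sym F p v w : smooth F -> inM p ->
  ddir (fun q => ddir F q v) p w = ddir (fun q => ddir F q w) p v.
Proof.
move=> sF pM; have sv := smooth_ddir v sF; have sw := smooth_ddir w sF.
have [d1 d10 [dv dw]] := plane_hasD v w sF pM.
have [d2 d20 [_ dvw]] := plane_hasD v w sv pM.
have [d3 d30 [dwv _]] := plane_hasD v w sw pM.
have C G : smooth G -> cont2 (fun s t => G (line (line p v s) w t)).
  by move=> /CkP/(_ 0%N)/Ck_cont cG; exact: cont2_plane.
have [d [d0 le1 le2 le3]] : exists d, [/\ 0 < d, d <= d1, d <= d2 & d <= d3].
  exists (Num.min d1 (Num.min d2 d3)).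
  by rewrite !lt_min d10 d20 d30 !ge_min !lexx !orbT.
have := schwarz2 (g := fun s t => F (line (line p v s) w t))
  (gs := fun s t => ddir F (line (line p v s) w t) v)
  (gt := fun s t => ddir F (line (line p v s) w t) w)
  (gst := fun s t => ddir (fun q => ddir F q v) (line (line p v s) w t) w)
  (gts := fun s t => ddir (fun q => ddir F q w) (line (line p v s) w t) v) d0
  (fun s t sd td => dv s t (lt_le_trans sd le1) (lt_le_trans td le1))
  (fun s t sd td => dw s t (lt_le_trans sd le1) (lt_le_trans td le1))
  (fun s t sd td => dvw s t (lt_le_trans sd le2) (lt_le_trans td le2))
  (fun s t sd td => dwv s t (lt_le_trans sd le3) (lt_le_trans td le3))
  (C _ (smooth_ddir w sv)) (C _ (smooth_ddir v sw)).
by rewrite !line0.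
Qed.
End Smooth.

(** * The trace form and the Yang-Baxter equation *)

Section TraceForm.
Variables (R : realType) (n : nat).
Local Notation Mat := (@Defs.Mat R n).
Implicit Types (X Y Z : Mat) (c : R).

Lemma ipC X Y : ip X Y = ip Y X.
Proof. by rewrite /ip mxtrace_mulC. Qed.
Lemma ipDl X Y Z : ip (X + Y) Z = ip X Z + ip Y Z.
Proof. by rewrite /ip mulmxDl mxtraceD ReD. Qed.
Lemma ipDr X Y Z : ip X (Y + Z) = ip X Y + ip X Z.
Proof. by rewrite ipC ipDl !(ipC X). Qed.
Lemma ipNl X Y : ip (- X) Y = - ip X Y.
Proof. by rewrite /ip mulNmx raddfN /= ReN. Qed.
Lemma ipNr X Y : ip X (- Y) = - ip X Y.
Proof. by rewrite ipC ipNl ipC. Qed.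
Lemma ipZl c X Y : ip (rsc c X) Y = c * ip X Y.
Proof. by rewrite /ip /rsc -scalemxAl mxtraceZ ReZ. Qed.
Lemma ipZr c X Y : ip X (rsc c Y) = c * ip X Y.
Proof. by rewrite ipC ipZl ipC. Qed.
Lemma ip0r X : ip X 0 = 0.
Proof. by rewrite /ip mulmx0 mxtrace0. Qed.
Lemma ip_mull X Y Z : ip (X *m Y) Z = ip X (Y *m Z).
Proof. by rewrite /ip mulmxA. Qed.
Lemma ip_mulr X Y Z : ip (X *m Y) Z = ip Y (Z *m X).
Proof. by rewrite ipC -ip_mull ipC. Qed.

Lemma ipE X Y : ip X Y = \sum_i \sum_j
  (complex.Re (X i j) * complex.Re (Y j i) - complex.Im (X i j) * complex.Im (Y j i)).
Proof.
rewrite /ip /mxtrace Re_sum; apply: eq_bigr => i _.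
by rewrite mxE Re_sum; apply: eq_bigr => j _; rewrite ReM.
Qed.

(** The invariant trilinear form <X, [Y, Z]>; its cyclicity transports linearity from the first slot
    to the others. *)
Definition tri X Y Z := ip X (Y *m Z - Z *m Y).

Lemma triE X Y Z : tri X Y Z = ip X (Y *m Z) - ip X (Z *m Y).
Proof. by rewrite /tri ipDr ipNr. Qed.
Lemma tri_rot X Y Z : tri X Y Z = tri Y Z X.
Proof. by rewrite !triE -(ip_mull X Y) ip_mulr -(ip_mulr Y X Z) ip_mull. Qed.
Lemma triDl X X' Y Z : tri (X + X') Y Z = tri X Y Z + tri X' Y Z.
Proof. exact: ipDl. Qed.
Lemma triDm X Y Y' Z : tri X (Y + Y') Z = tri X Y Z + tri X Y' Z.
Proof. by rewrite tri_rot triDl (tri_rot X Y) (tri_rot X Y'). Qed.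
Lemma triDr X Y Z Z' : tri X Y (Z + Z') = tri X Y Z + tri X Y Z'.
Proof. by rewrite -tri_rot triDl (tri_rot Z) (tri_rot Z'). Qed.
Lemma triNl X Y Z : tri (- X) Y Z = - tri X Y Z.
Proof. exact: ipNl. Qed.
Lemma triNm X Y Z : tri X (- Y) Z = - tri X Y Z.
Proof. by rewrite tri_rot triNl (tri_rot X Y). Qed.
Lemma triNr X Y Z : tri X Y (- Z) = - tri X Y Z.
Proof. by rewrite -tri_rot triNl (tri_rot Z). Qed.
Lemma triZl c X Y Z : tri (rsc c X) Y Z = c * tri X Y Z.
Proof. exact: ipZl. Qed.
Lemma triZm c X Y Z : tri X (rsc c Y) Z = c * tri X Y Z.
Proof. by rewrite tri_rot triZl (tri_rot X Y). Qed.
Lemma triZr c X Y Z : tri X Y (rsc c Z) = c * tri X Y Z.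
Proof. by rewrite -tri_rot triZl (tri_rot Z). Qed.

(** The operator [rr] is diagonal in the basis of elementary matrices, with half this sign as
    eigenvalues. *)
Definition sgr (i j : 'I_n) : R[i] := (i < j)%N%:R - (j < i)%N%:R.

Lemma rr_entry X i j : rr X i j = 2^-1 * sgr i j * X i j.
Proof.
rewrite /rr /rsc !mxE /sgr fmorphV rmorph_nat.
by case: ltngtP => _ /=; ring.
Qed.

Lemma rr_anti X Y : ip (rr X) Y = - ip X (rr Y).
Proof.
rewrite /ip -ReN -raddfN /= -mulmxN; congr complex.Re.
rewrite /mxtrace; apply: eq_bigr => i _; rewrite !mxE; apply: eq_bigr => j _.
rewrite [in RHS]mxE !rr_entry /sgr; ring.
Qed.

Lemma trace3E X Y Z : \tr (X *m (Y *m Z)) = \sum_i \sum_j \sum_k X i j * Y j k * Z k i.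
Proof.
apply: eq_bigr => i _; rewrite mxE; apply: eq_bigr => j _.
by rewrite mxE mulr_sumr; apply: eq_bigr => k _; rewrite mulrA.
Qed.

(* Among the three cyclic order signs of (i, j, k) the pairwise products sum to -1,
   unless i = j = k, where they sum to 0. *)
Lemma sgr_cycle i j k : sgr i j * sgr j k + sgr j k * sgr k i + sgr k i * sgr i j + 1
  = ((i == j) && (j == k))%:R.
Proof.
rewrite /sgr -!(inj_eq val_inj) /=.
by case: (ltngtP i j) => ij; case: (ltngtP j k) => jk; case: (ltngtP i k) => ik /=;
  try lia; ring.
Qed.

(** Entrywise, each of the first three traces carries a product of two cyclic order signs; by
    [sgr_cycle] the total is supported on diagonal entries. *)
Lemma rr_cycle X Y Z :
  \tr (X *m (rr Y *m rr Z)) + \tr (rr X *m (Y *m rr Z)) + \tr (rr X *m (rr Y *m Z))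
    + 4^-1 * \tr (X *m (Y *m Z))
  = \sum_i \sum_j \sum_k 4^-1 * ((i == j) && (j == k))%:R * (X i j * Y j k * Z k i).
Proof.
rewrite !trace3E mulr_sumr -!big_split; apply: eq_bigr => i _.
rewrite /= mulr_sumr -!big_split; apply: eq_bigr => j _.
rewrite /= mulr_sumr -!big_split; apply: eq_bigr => k _.
rewrite /= -sgr_cycle !rr_entry; by field.
Qed.

(** The modified classical Yang-Baxter equation paired with [X], the outer [rr] being moved onto [X]
    by antisymmetry. It is the difference of [rr_cycle] for (X, Y, Z) and (X, Z, Y), in which the
    diagonal contributions cancel. *)
Lemma rr_yang_baxter X Y Z :
  tri X (rr Y) (rr Z) + tri (rr X) Y (rr Z) + tri (rr X) (rr Y) Z = - (4^-1 * tri X Y Z).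
Proof.
have ReE (a b c d s : R[i]) : a + b + c + 4^-1 * d = s ->
    complex.Re a + complex.Re b + complex.Re c + 4^-1 * complex.Re d = complex.Re s.
  have -> : 4^-1 = ((4^-1 : R)%:C)%C :> R[i] by rewrite fmorphV rmorph_nat.
  by move=> <-; rewrite !ReD ReZ.
have ipE3 (U V W : Mat) : ip U (rr V *m rr W) + ip (rr U) (V *m rr W) + ip (rr U) (rr V *m W)
    + 4^-1 * ip U (V *m W) = complex.Re (\sum_i \sum_j \sum_k
      4^-1 * ((i == j) && (j == k))%:R * (U i j * V j k * W k i)).
  exact: ReE (rr_cycle U V W).
have := ipE3 X Y Z; have := ipE3 X Z Y.
have -> : \sum_i \sum_j \sum_k 4^-1 * ((i == j) && (j == k))%:R * (X i j * Z j k * Y k i)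
  = \sum_i \sum_j \sum_k 4^-1 * ((i == j) && (j == k))%:R * (X i j * Y j k * Z k i).
  apply: eq_bigr => i _; apply: eq_bigr => j _; apply: eq_bigr => k _.
  have [<-|_] := eqVneq i j; last by rewrite mulr0 !mul0r.
  have [<-|_] := eqVneq i k; last by rewrite mulr0 !mul0r.
  by congr (_ * _); rewrite mulrAC.
move=> <-; rewrite !triE.
(* Generalising over the form and [rr] makes their values atoms for linear arithmetic. *)
move: (@ip R n) (@rr R n) => f r e.
lra.
Qed.
End TraceForm.

(** * The constant operator on gl(n,C)^4 and its Schouten bracket *)

Section Schouten.
Variables (R : realType) (n : nat).
Local Notation Pt := (@Defs.Pt R n).
Local Notation Mat := (@Defs.Mat R n).
Implicit Types (p v a b c : Pt) (x y z : Pt * Pt).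

Definition pip a v : R := ip a.1 v.1 + ip a.2 v.2.
Definition qip x y : R := pip x.1 y.1 + pip x.2 y.2.

(** Components are ordered as nabla_1, nabla_1', nabla_2, nabla_2'. On the diagonal of the nabla_2
    block [rr] replaces [rminus] and [rplus], which makes the operator antisymmetric; the dropped
    terms cancel on derivatives of functions, as shown in [bracket2E]. *)
Definition rho x : Pt * Pt :=
  ((rplus x.2.2 - rminus x.2.1 - rr x.1.1, rr x.1.2),
   (rplus x.2.2 - rr x.2.1 - rplus x.1.1, rminus x.2.1 - rr x.2.2 + rminus x.1.1)).

(** Since [rr] is antisymmetric, the adjoint of [rplus] is minus [rminus], which matches each
    off-diagonal block with its transpose. *)
Lemma rho_anti x y : qip x (rho y) = - qip y (rho x).
Proof.
case: x => [[x1 x1'] [x2 x2']]; case: y => [[y1 y1'] [y2 y2']].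
rewrite /qip /pip /rho /rplus /rminus /=.
have E (A B : Mat) : ip A (rr B) = - ip B (rr A) by rewrite ipC rr_anti.
move: (@rr R n) E => r E.
rewrite !ipDr !ipNr !ipDr !ipNr !ipZr.
rewrite ![ip y1 (r _)]E ![ip y1' (r _)]E ![ip y2 (r _)]E ![ip y2' (r _)]E.
rewrite ![ip y1 _]ipC ![ip y2 _]ipC ![ip y2' _]ipC.
move: (@ip R n) => f; lra.
Qed.

Definition comm (X Y : Mat) : Mat := X *m Y - Y *m X.
(** The Lie bracket of four copies of gl(n,C), with opposite sign on the two that act by right
    multiplication. *)
Definition qcomm x y : Pt * Pt :=
  ((comm x.1.1 y.1.1, - comm x.1.2 y.1.2), (comm x.2.1 y.2.1, - comm x.2.2 y.2.2)).

Lemma schouten_rho x y z :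
  qip x (qcomm (rho y) (rho z)) + qip y (qcomm (rho z) (rho x))
    + qip z (qcomm (rho x) (rho y))
  = 4^-1 * (tri x.1.2 y.1.2 z.1.2 - tri x.1.1 y.1.1 z.1.1
            + tri x.2.2 y.2.2 z.2.2 - tri x.2.1 y.2.1 z.2.1).
Proof.
case: x => [[x1 x1'] [x2 x2']]; case: y => [[y1 y1'] [y2 y2']].
case: z => [[z1 z1'] [z2 z2']].
rewrite /qip /pip /qcomm /comm /rho /rplus /rminus /= !ipNr -!/(tri _ _ _).
(* Cyclic rotations bring every term to the argument order x, y, z. *)
rewrite ![tri y1 _ _]tri_rot ![tri y1' _ _]tri_rot ![tri y2 _ _]tri_rot ![tri y2' _ _]tri_rot.
rewrite ![tri _ _ y1]tri_rot ![tri _ _ y1']tri_rot ![tri _ _ y2]tri_rot ![tri _ _ y2']tri_rot.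
rewrite ![tri z1 _ _]tri_rot ![tri z1' _ _]tri_rot ![tri z2 _ _]tri_rot ![tri z2' _ _]tri_rot.
(* The Yang-Baxter equation, solved for the term with [rr] on the last two slots; eliminating such
   terms leaves a linear identity. *)
have E (X Y Z : Mat) : tri X (rr Y) (rr Z)
  = - (4^-1 * tri X Y Z) - tri (rr X) Y (rr Z) - tri (rr X) (rr Y) Z.
  by rewrite -[4^-1 * _]opprK -(rr_yang_baxter X Y Z) opprK [_ + tri (rr X) (rr Y) Z]addrC
    [X in _ = X - _]addrC; move: (@tri R n) (@rr R n) => T r; lra.
move: (@rr R n) E => r E.
rewrite !triDl !triDm !triDr.
rewrite !triNl !triNm !triNr.
rewrite !triDl !triDm !triDr.
rewrite !triNl !triNm !triNr.
rewrite !triZl !triZm !triZr.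
rewrite !E.
move: (@tri R n) => T {E}.
lra.
Qed.
End Schouten.

(** * Gradients *)

Section Gradient.
Variables (R : realType) (n : nat).
Local Notation Pt := (@Defs.Pt R n).
Local Notation Mat := (@Defs.Mat R n).
Implicit Types (p q v w : Pt) (X Y : Mat) (F G H : Pt -> R) (A B : Pt -> Mat).

Lemma mxtrace_delta X i j (c : R[i]) : \tr (X *m (c *: delta_mx j i)) = c * X i j.
Proof.
rewrite -scalemxAr mxtraceZ; congr (_ * _).
rewrite /mxtrace (bigD1 i) //= big1 ?addr0 => [|k ki].
  rewrite mxE (bigD1 j) //= big1 ?addr0 => [|l lj]; first by rewrite mxE !eqxx mulr1.
  by rewrite mxE (negbTE lj) mulr0.
by rewrite mxE big1 // => l _; rewrite mxE (negbTE ki) andbF mulr0.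
Qed.

Lemma riesz_ip X : riesz (ip X) = X.
Proof.
apply/matrixP => i j; rewrite mxE /ip -[delta_mx j i]scale1r scalerA mulr1.
rewrite !mxtrace_delta mul1r; apply: complex_eq => //=.
by rewrite ReM /= mul0r mul1r sub0r opprK.
Qed.

(** The matrices E_ij and i E_ij form a real basis, and [riesz] records the values of the functional
    on it. *)
Lemma riesz_repr (L : Mat -> R) :
  (forall X Y, L (X + Y) = L X + L Y) -> (forall c X, L (rsc c X) = c * L X) ->
  forall X, L X = ip (riesz L) X.
Proof.
move=> LD LZ X.
have L0 : L 0 = 0 by rewrite -(rsc0 0) LZ mul0r.
have Lsum (I : finType) (f : I -> Mat) : L (\sum_i f i) = \sum_i L (f i).
  exact: (big_morph L LD L0).
rewrite ipE exchange_big [X in L X]matrix_sum_delta Lsum; apply: eq_bigr => i _.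
rewrite Lsum; apply: eq_bigr => j _.
have -> : X i j *: delta_mx i j = rsc (complex.Re (X i j)) (delta_mx i j)
    + rsc (complex.Im (X i j)) (('i)%C *: delta_mx i j) :> Mat.
  by rewrite /rsc scalerA -scalerDl [_ * ('i)%C]mulrC -complexE.
by rewrite LD !LZ mxE /=; ring.
Qed.

(** The gradient for additive displacements of g and J; translation derivatives arise from it by
    multiplication with g or J. *)
Definition grad F p : Pt :=
  (riesz (fun X => ddir F p (X, 0)), riesz (fun X => ddir F p (0, X))).

Lemma ddir_grad F p v : smooth F -> inM p -> ddir F p v = pip (grad F p) v.
Proof.
move=> sF pM; case: v => v1 v2.
have pD (a b c d : Mat) : ((a, b) : Pt) + (c, d) = (a + c, b + d) by [].
have rsc00 c : rsc c 0 = 0 :> Mat by exact: scaler0.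
have -> : (v1, v2) = (v1, 0) + (0, v2) :> Pt by rewrite pD addr0 add0r.
rewrite (ddirD _ _ sF pM) /pip pD addr0 add0r; congr (_ + _).
  apply: (riesz_repr (L := fun X => ddir F p (X, 0))) => [X Y|c X].
    by rewrite -(ddirD _ _ sF pM) pD addr0.
  by rewrite -(ddir_scale _ _ sF pM) /= rsc00.
apply: (riesz_repr (L := fun X => ddir F p (0, X))) => [X Y|c X].
  by rewrite -(ddirD _ _ sF pM) pD addr0.
by rewrite -(ddir_scale _ _ sF pM) /= rsc00.
Qed.

(** The gradient is paired with the direction X g, and cyclicity of the trace moves g to its
    left. *)
Lemma nabla1E F p : smooth F -> inM p -> nabla1 F p = p.1 *m (grad F p).1.
Proof.
move=> sF pM; rewrite -[RHS]riesz_ip /nabla1; congr riesz; apply/funext => X.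
rewrite (ddir_grad _ sF pM); move: (grad F p) => a.
by rewrite /pip (ip0r a.2) addr0 (ip_mulr p.1).
Qed.

Lemma nabla1'E F p : smooth F -> inM p -> nabla1' F p = (grad F p).1 *m p.1.
Proof.
move=> sF pM; rewrite -[RHS]riesz_ip /nabla1'; congr riesz; apply/funext => X.
rewrite (ddir_grad _ sF pM); move: (grad F p) => a.
by rewrite /pip (ip0r a.2) addr0 (ip_mull a.1).
Qed.

(** * Smoothness and derivatives of matrix-valued functions, entry by entry *)

Definition msmooth A := forall i j,
  smooth (fun q => complex.Re (A q i j)) /\ smooth (fun q => complex.Im (A q i j)).
Definition mhasD A p v X := forall i j,
  hasD (fun q => complex.Re (A q i j)) p v (complex.Re (X i j)) /\
  hasD (fun q => complex.Im (A q i j)) p v (complex.Im (X i j)).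

Lemma eq_fun_smooth F G : F =1 G -> smooth F -> smooth G.
Proof. by move=> /funext ->. Qed.
Lemma eq_fun_hasD F G p v a b : F =1 G -> a = b -> hasD F p v a -> hasD G p v b.
Proof. by move=> /funext -> ->. Qed.

Lemma smooth_sum (I : finType) (f : I -> Pt -> R) :
  (forall i, smooth (f i)) -> smooth (fun q => \sum_i f i q).
Proof.
move=> sf; elim: (index_enum I) => [|i r IH].
  by apply: eq_fun_smooth (smooth_cst n 0) => q; rewrite big_nil.
by apply: eq_fun_smooth (smoothD (sf i) IH) => q; rewrite big_cons.
Qed.
Lemma hasD_sum (I : finType) (f : I -> Pt -> R) (a : I -> R) p v :
  (forall i, hasD (f i) p v (a i)) -> hasD (fun q => \sum_i f i q) p v (\sum_i a i).
Proof.
move=> sf; elim: (index_enum I) => [|i r IH].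
  by apply: eq_fun_hasD (hasD_cst 0 p v) => [q|]; rewrite big_nil.
by apply: eq_fun_hasD (hasDD (sf i) IH) => [q|]; rewrite big_cons.
Qed.

Lemma msmooth_fst : msmooth (@fst Mat Mat).
Proof.
move=> i j; split.
  apply: (smooth_affine (F' := fun v => complex.Re (v.1 i j))).
    by apply/cont_on_MP => p _; have [] := ccont_entry1 i j p.
  by move=> v p; apply: hasD_affine => t; rewrite /= !mxE ReD ReZ.
apply: (smooth_affine (F' := fun v => complex.Im (v.1 i j))).
  by apply/cont_on_MP => p _; have [] := ccont_entry1 i j p.
by move=> v p; apply: hasD_affine => t; rewrite /= !mxE ImD ImZ.
Qed.
Lemma msmooth_snd : msmooth (@snd Mat Mat).
Proof.
move=> i j; split.
  apply: (smooth_affine (F' := fun v => complex.Re (v.2 i j))).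
    by apply/cont_on_MP => p _; have [] := ccont_entry2 i j p.
  by move=> v p; apply: hasD_affine => t; rewrite /= !mxE ReD ReZ.
apply: (smooth_affine (F' := fun v => complex.Im (v.2 i j))).
  by apply/cont_on_MP => p _; have [] := ccont_entry2 i j p.
by move=> v p; apply: hasD_affine => t; rewrite /= !mxE ImD ImZ.
Qed.
Lemma mhasD_fst p v : mhasD (@fst Mat Mat) p v v.1.
Proof. by move=> i j; split; apply: hasD_affine => t; rewrite /= !mxE ?ReD ?ImD ?ReZ ?ImZ. Qed.
Lemma mhasD_snd p v : mhasD (@snd Mat Mat) p v v.2.
Proof. by move=> i j; split; apply: hasD_affine => t; rewrite /= !mxE ?ReD ?ImD ?ReZ ?ImZ. Qed.

Lemma msmoothD A B : msmooth A -> msmooth B -> msmooth (fun q => A q + B q).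
Proof.
move=> sA sB i j; have [A1 A2] := sA i j; have [B1 B2] := sB i j; split.
  by apply: eq_fun_smooth (smoothD A1 B1) => q; rewrite mxE ReD.
by apply: eq_fun_smooth (smoothD A2 B2) => q; rewrite mxE ImD.
Qed.
Lemma mhasDD A B p v X Y : mhasD A p v X -> mhasD B p v Y ->
  mhasD (fun q => A q + B q) p v (X + Y).
Proof.
move=> sA sB i j; have [A1 A2] := sA i j; have [B1 B2] := sB i j; split.
  by apply: eq_fun_hasD (hasDD A1 B1) => [q|]; rewrite mxE ReD.
by apply: eq_fun_hasD (hasDD A2 B2) => [q|]; rewrite mxE ImD.
Qed.
Lemma msmoothN A : msmooth A -> msmooth (fun q => - A q).
Proof.
move=> sA i j; have [A1 A2] := sA i j; split.
  by apply: eq_fun_smooth (smoothN A1) => q; rewrite mxE ReN.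
by apply: eq_fun_smooth (smoothN A2) => q; rewrite mxE ImN.
Qed.
Lemma mhasDN A p v X : mhasD A p v X -> mhasD (fun q => - A q) p v (- X).
Proof.
move=> sA i j; have [A1 A2] := sA i j; split.
  by apply: eq_fun_hasD (hasDN A1) => [q|]; rewrite mxE ReN.
by apply: eq_fun_hasD (hasDN A2) => [q|]; rewrite mxE ImN.
Qed.
Lemma msmoothM A B : msmooth A -> msmooth B -> msmooth (fun q => A q *m B q).
Proof.
move=> sA sB i j; split.
  apply: eq_fun_smooth (_ : smooth (fun q => \sum_k
    (complex.Re (A q i k) * complex.Re (B q k j)
     + - (complex.Im (A q i k) * complex.Im (B q k j))))) => [q|].
    by rewrite mxE Re_sum; apply: eq_bigr => k _; rewrite ReM.
  apply: smooth_sum => k; have [A1 A2] := sA i k; have [B1 B2] := sB k j.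
  by apply: smoothD; [exact: smoothM|apply: smoothN; exact: smoothM].
apply: eq_fun_smooth (_ : smooth (fun q => \sum_k
    (complex.Re (A q i k) * complex.Im (B q k j)
     + complex.Im (A q i k) * complex.Re (B q k j)))) => [q|].
  by rewrite mxE Im_sum; apply: eq_bigr => k _; rewrite ImM.
apply: smooth_sum => k; have [A1 A2] := sA i k; have [B1 B2] := sB k j.
by apply: smoothD; exact: smoothM.
Qed.
Lemma mhasDM A B p v X Y : mhasD A p v X -> mhasD B p v Y ->
  mhasD (fun q => A q *m B q) p v (X *m B p + A p *m Y).
Proof.
move=> sA sB i j; split.
  apply: eq_fun_hasD (hasD_sum (f := fun k q =>
    complex.Re (A q i k) * complex.Re (B q k j)
     + - (complex.Im (A q i k) * complex.Im (B q k j)))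
    (a := fun k =>
    (complex.Re (X i k) * complex.Re (B p k j) + complex.Re (A p i k) * complex.Re (Y k j))
     + - (complex.Im (X i k) * complex.Im (B p k j) + complex.Im (A p i k) * complex.Im (Y k j)))
    _) => [q||k].
  - by rewrite mxE Re_sum; apply: eq_bigr => k _; rewrite ReM.
  - rewrite !mxE -big_split Re_sum; apply: eq_bigr => k _; rewrite ReD !ReM; ring.
  - have [A1 A2] := sA i k; have [B1 B2] := sB k j.
    by apply: hasDD; [exact: hasDM|apply: hasDN; exact: hasDM].
apply: eq_fun_hasD (hasD_sum (f := fun k q =>
    complex.Re (A q i k) * complex.Im (B q k j)
     + complex.Im (A q i k) * complex.Re (B q k j))
    (a := fun k =>
    (complex.Re (X i k) * complex.Im (B p k j) + complex.Re (A p i k) * complex.Im (Y k j))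
     + (complex.Im (X i k) * complex.Re (B p k j) + complex.Im (A p i k) * complex.Re (Y k j)))
    _) => [q||k].
- by rewrite mxE Im_sum; apply: eq_bigr => k _; rewrite ImM.
- rewrite !mxE -big_split Im_sum; apply: eq_bigr => k _; rewrite ImD !ImM; ring.
- have [A1 A2] := sA i k; have [B1 B2] := sB k j.
  by apply: hasDD; exact: hasDM.
Qed.

Lemma smooth_ip A B : msmooth A -> msmooth B -> smooth (fun q => ip (A q) (B q)).
Proof.
move=> sA sB; apply: eq_fun_smooth (_ : smooth (fun q => \sum_i
   complex.Re ((A q *m B q) i i))) => [q|]; first by rewrite /ip /mxtrace Re_sum.
by apply: smooth_sum => i; have [] := msmoothM sA sB i i.
Qed.
Lemma hasD_ip A B p v X Y : mhasD A p v X -> mhasD B p v Y ->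
  hasD (fun q => ip (A q) (B q)) p v (ip X (B p) + ip (A p) Y).
Proof.
move=> sA sB; apply: eq_fun_hasD (hasD_sum (f := fun i q => complex.Re ((A q *m B q) i i))
  (a := fun i => complex.Re ((X *m B p + A p *m Y) i i)) _) => [q||i].
- by rewrite /ip /mxtrace Re_sum.
- by rewrite /ip -ReD -mxtraceD /mxtrace Re_sum.
- by have [] := mhasDM sA sB i i.
Qed.

Lemma msmooth_grad F : smooth F ->
  msmooth (fun q => (grad F q).1) /\ msmooth (fun q => (grad F q).2).
Proof.
move=> sF; split=> i j; split.
- by apply: eq_fun_smooth (smooth_ddir (delta_mx j i, 0) sF) => q; rewrite mxE.
- apply: eq_fun_smooth (smoothN (smooth_ddir (('i)%C *: delta_mx j i, 0) sF)) => q.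
  by rewrite mxE.
- by apply: eq_fun_smooth (smooth_ddir (0, delta_mx j i) sF) => q; rewrite mxE.
- apply: eq_fun_smooth (smoothN (smooth_ddir (0, ('i)%C *: delta_mx j i) sF)) => q.
  by rewrite mxE.
Qed.

(** Gradient entries are directional derivatives up to sign, so symmetry of the Hessian lets the
    derivative along [v] be taken first. *)
Lemma mhasD_grad F p v : smooth F -> inM p ->
  mhasD (fun q => (grad F q).1) p v (grad (fun q => ddir F q v) p).1 /\
  mhasD (fun q => (grad F q).2) p v (grad (fun q => ddir F q v) p).2.
Proof.
move=> sF pM.
have E w : hasD (fun q => ddir F q w) p v (ddir (fun q => ddir F q v) p w).
  by apply: hasD_eq (smooth_hasD v (smooth_ddir w sF) pM) _; exact: hessian_sym.
split=> i j; split.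
- by apply: eq_fun_hasD (E (delta_mx j i, 0)) => [q|]; rewrite mxE.
- by apply: eq_fun_hasD (hasDN (E (('i)%C *: delta_mx j i, 0))) => [q|]; rewrite mxE.
- by apply: eq_fun_hasD (E (0, delta_mx j i)) => [q|]; rewrite mxE.
- by apply: eq_fun_hasD (hasDN (E (0, ('i)%C *: delta_mx j i))) => [q|]; rewrite mxE.
Qed.

End Gradient.

(** * Poisson brackets *)

Section PoissonCriterion.
Variables (R : realType) (n : nat).
Local Notation Pt := (@Defs.Pt R n).
Local Notation Mat := (@Defs.Mat R n).
Implicit Types (p q v w a b c : Pt) (F G H : Pt -> R) (al be : Pt -> Pt).

Lemma pipDl a b v : pip (a + b) v = pip a v + pip b v.
Proof. by rewrite /pip !ipDl addrACA. Qed.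

Definition psmooth al := msmooth (fun q => (al q).1) /\ msmooth (fun q => (al q).2).
Definition phasD al p v a :=
  mhasD (fun q => (al q).1) p v a.1 /\ mhasD (fun q => (al q).2) p v a.2.

(* The second derivatives of F, G, H cancel in the Jacobi identity because Hessians
   are symmetric and Pi is antisymmetric; what remains is the cyclic sum of the
   derivatives DPi of the bivector Pi along its own Hamiltonian vector fields V. *)
Lemma poisson_criterion (B : (Pt -> R) -> (Pt -> R) -> (Pt -> R))
    (Pi : Pt -> Pt -> Pt -> R) (V : Pt -> Pt -> Pt) (DPi : Pt -> Pt -> Pt -> Pt -> R) :
  (forall F H, smooth F -> smooth H -> forall p, inM p ->
     B F H p = Pi p (grad F p) (grad H p)) ->
  (forall p a b, Pi p a b = pip a (V p b)) ->
  (forall p a b, Pi p a b = - Pi p b a) ->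
  (forall al be, psmooth al -> psmooth be -> smooth (fun q => Pi q (al q) (be q))) ->
  (forall al be p v a b, phasD al p v a -> phasD be p v b ->
     hasD (fun q => Pi q (al q) (be q)) p v
       (DPi p v (al p) (be p) + (Pi p a (be p) + Pi p (al p) b))) ->
  (forall p a b c, DPi p (V p a) b c + DPi p (V p b) c a + DPi p (V p c) a b = 0) ->
  poisson_bracket B.
Proof.
move=> BE PiV PiN Pis PiD cyc.
have sB F H : smooth F -> smooth H -> smooth (B F H).
  move=> sF sH; apply: eq_smooth (Pis _ _ (msmooth_grad sF) (msmooth_grad sH)) => q qM.
  by rewrite BE.
have BV F H p : smooth F -> smooth H -> inM p -> B F H p = ddir F p (V p (grad H p)).
  by move=> sF sH pM; rewrite (BE _ _ sF sH _ pM) PiV (ddir_grad _ sF pM).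
have BN F H p : smooth F -> smooth H -> inM p -> B F H p = - B H F p.
  by move=> sF sH pM; rewrite (BE _ _ sF sH _ pM) (BE _ _ sH sF _ pM) PiN.
split=> //.
- move=> a b F G H sF sG sH p pM.
  have sL : smooth (fun q => a * F q + b * G q).
    by apply: smoothD; apply: smoothM => //; exact: smooth_cst.
  rewrite (BV _ _ _ sL sH pM) (BV _ _ _ sF sH pM) (BV _ _ _ sG sH pM).
  apply: hasD_ddir; set v := V _ _.
  have := hasDD (hasDM (hasD_cst a p v) (smooth_hasD v sF pM))
    (hasDM (hasD_cst b p v) (smooth_hasD v sG pM)).
  by move=> h; apply: hasD_eq h _; rewrite !mul0r !add0r.
- by move=> F H sF sH p pM; exact: BN.
- move=> F G H sF sG sH p pM.
  (* In its first slot [B] is a derivative along a vector, hence a derivation; antisymmetry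
     transports this to the second slot. *)
  rewrite (BN _ _ _ sF (smoothM sG sH) pM) (BN _ _ _ sF sG pM) (BN _ _ _ sF sH pM).
  rewrite (BV _ _ _ (smoothM sG sH) sF pM) (BV _ _ _ sG sF pM) (BV _ _ _ sH sF pM).
  rewrite (hasD_ddir (hasDM (smooth_hasD _ sG pM) (smooth_hasD _ sH pM))).
  by rewrite opprD mulNr mulrN.
- move=> F G H sF sG sH p pM.
  pose hs L u w := ddir (fun q => ddir L q u) p w.
  have hsC L u w : smooth L -> hs L u w = hs L w u by move=> sL; exact: hessian_sym.
  (* Bracketing with [K] on the left is minus the derivative along the Hamiltonian vector of [K];
     the product rule gives one derivative of the bivector and two Hessian terms. *)
  have BB K L M : smooth K -> smooth L -> smooth M -> B K (B L M) p =
      - DPi p (V p (grad K p)) (grad L p) (grad M p)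
      - hs L (V p (grad K p)) (V p (grad M p)) + hs M (V p (grad K p)) (V p (grad L p)).
    move=> sK sL sM; rewrite (BN _ _ _ sK (sB _ _ sL sM) pM).
    rewrite (BV _ _ _ (sB _ _ sL sM) sK pM); set u := V p (grad K p).
    have := PiD _ _ p u _ _ (mhasD_grad u sL pM) (mhasD_grad u sM pM).
    have E q : inM q -> Pi q (grad L q) (grad M q) = B L M q by move=> qM; rewrite BE.
    move=> /(hasD_congr E pM) /hasD_ddir ->.
    have PiE K' x : smooth K' -> Pi p (grad K' p) x = ddir K' p (V p x).
      by move=> sK'; rewrite PiV (ddir_grad _ sK' pM).
    rewrite (PiE _ _ (smooth_ddir u sL)) (PiN _ _ (grad (fun q => ddir M q u) p)).
    by rewrite (PiE _ _ (smooth_ddir u sM)) !opprD opprK addrA.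
  rewrite (BB _ _ _ sF sG sH) (BB _ _ _ sG sH sF) (BB _ _ _ sH sF sG).
  have := cyc p (grad F p) (grad G p) (grad H p).
  move: (grad F p) (grad G p) (grad H p) => a b c {BB}; clearbody hs.
  rewrite (hsC F (V p b) (V p c) sF) (hsC G (V p c) (V p a) sG) (hsC H (V p a) (V p b) sH).
  lra.
Qed.
End PoissonCriterion.

(** * The first bracket, linear in (g, J) *)

Section Linear.
Variables (R : realType) (n : nat).
Local Notation Pt := (@Defs.Pt R n).
Local Notation Mat := (@Defs.Mat R n).
Implicit Types (p q v w a b c : Pt) (X Y Z : Mat).

(** Linear in the point, so its derivative along [v] at fixed covectors is [Pi1 v]. *)
Definition Pi1 p a b : R :=
  ip (p.1 *m a.1) b.2 - ip (p.1 *m b.1) a.2 + ip p.2 (a.2 *m b.2 - b.2 *m a.2).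
Definition V1 p b : Pt := (b.2 *m p.1, (b.2 *m p.2 - p.2 *m b.2) - p.1 *m b.1).

Lemma Pi1_V1 p a b : Pi1 p a b = pip a (V1 p b).
Proof.
rewrite /Pi1 /pip /V1 /= !ipDr !ipNr (ip_mulr p.1 a.1).
rewrite (ipC p.2 (a.2 *m _)) (ip_mull a.2) (ipC p.2 (b.2 *m _)) (ip_mulr b.2 a.2).
rewrite (ipC (p.1 *m b.1)); move: (@ip R n) => f; lra.
Qed.

Lemma Pi1_anti p a b : Pi1 p a b = - Pi1 p b a.
Proof.
rewrite /Pi1 !ipDr !ipNr; move: (ip _ b.2) (ip _ a.2) (ip _ (a.2 *m b.2)) => x y z.
by lra.
Qed.

(** Invariance of the form turns the sum into the pairing of [W] with the cyclic sum of nested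
    commutators. *)
Lemma jacobi X Y Z W :
  ip (X *m W - W *m X) (Y *m Z - Z *m Y) + ip (Y *m W - W *m Y) (Z *m X - X *m Z)
  + ip (Z *m W - W *m Z) (X *m Y - Y *m X) = 0.
Proof.
have E A B : ip (A *m W - W *m A) B = ip W (B *m A - A *m B).
  by rewrite ipDl ipNl ipDr ipNr ip_mulr ip_mull.
rewrite !E -!ipDr !(mulmxBl, mulmxBr) !mulmxA.
rewrite (_ : _ + _ = 0) ?ip0r //.
by apply/matrixP => i j; rewrite !mxE; ring.
Qed.

Lemma Pi1_cyclic p a b c :
  Pi1 (V1 p a) b c + Pi1 (V1 p b) c a + Pi1 (V1 p c) a b = 0.
Proof.
(* The first pairing is a term of the Jacobi identity; the other four cancel in the cyclic sum. *)
have E x y z : Pi1 (V1 p x) y z = ip (x.2 *m p.2 - p.2 *m x.2) (y.2 *m z.2 - z.2 *m y.2)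
  + (ip (p.1 *m y.1) (z.2 *m x.2) - ip (p.1 *m z.1) (y.2 *m x.2)
  - ip (p.1 *m x.1) (y.2 *m z.2) + ip (p.1 *m x.1) (z.2 *m y.2)).
  rewrite /Pi1 /V1 /= -!mulmxA !(ip_mulr x.2 (p.1 *m _)).
  rewrite [ip (_ - p.1 *m _) _]ipDl ipNl [ip (p.1 *m x.1) (_ - _)]ipDr ipNr.
  move: (@ip R n) => f; lra.
rewrite !E; have := jacobi a.2 b.2 c.2 p.2; move: (@ip R n) => f; lra.
Qed.

Lemma bracket1_poisson : poisson_bracket (@bracket1 R n).
Proof.
apply: (poisson_criterion (Pi := Pi1) (V := V1) (DPi := fun p v => Pi1 v)).
- move=> F H sF sH p pM; rewrite /bracket1 (nabla1E sF pM) (nabla1E sH pM) /Pi1.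
  by [].
- exact: Pi1_V1.
- exact: Pi1_anti.
- move=> al be [a1 a2] [b1 b2]; apply: smoothD; first apply: smoothD.
  + exact: smooth_ip (msmoothM (@msmooth_fst R n) a1) b2.
  + apply: smoothN; exact: smooth_ip (msmoothM (@msmooth_fst R n) b1) a2.
  + apply: (smooth_ip (@msmooth_snd R n)); apply: msmoothD; first exact: msmoothM.
    by apply: msmoothN; exact: msmoothM.
- move=> al be p v a b [a1 a2] [b1 b2].
  have g := mhasD_fst p v; have J := mhasD_snd p v.
  apply: hasD_eq (hasDD (hasDD (hasD_ip (mhasDM g a1) b2)
     (hasDN (hasD_ip (mhasDM g b1) a2)))
     (hasD_ip J (mhasDD (mhasDM a2 b2) (mhasDN (mhasDM b2 a2))))) _.
  rewrite /Pi1 !ipDl !ipDr !ipNr !ipDr; move: (@ip R n) => f; lra.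
- exact: Pi1_cyclic.
Qed.
End Linear.

(** * The second bracket, quadratic in (g, J) *)

Section Quadratic.
Variables (R : realType) (n : nat).
Local Notation Pt := (@Defs.Pt R n).
Local Notation Mat := (@Defs.Mat R n).
Implicit Types (p q v w a b c : Pt) (X Y Z : Mat) (A : Pt -> Mat)
  (s : 'I_n -> 'I_n -> R) (x y : Pt * Pt)
  (xi : Pt -> Pt * Pt).

(** Both [rr] and real scaling multiply entries by fixed real numbers, so one argument serves
    both. *)
Definition escale (s : 'I_n -> 'I_n -> R) X : Mat := \matrix_(i, j) (((s i j)%:C)%C * X i j).

Lemma msmooth_escale s A : msmooth A -> msmooth (fun q => escale s (A q)).
Proof.
move=> sA i j; have [A1 A2] := sA i j; split.
  by apply: eq_fun_smooth (smoothM (smooth_cst n (s i j)) A1) => q; rewrite mxE ReZ.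
by apply: eq_fun_smooth (smoothM (smooth_cst n (s i j)) A2) => q; rewrite mxE ImZ.
Qed.
Lemma mhasD_escale s A p v X : mhasD A p v X ->
  mhasD (fun q => escale s (A q)) p v (escale s X).
Proof.
move=> sA i j; have [A1 A2] := sA i j; split.
  apply: eq_fun_hasD (hasDM (hasD_cst (s i j) p v) A1) => [q|]; rewrite mxE ReZ //.
  by rewrite mul0r add0r.
apply: eq_fun_hasD (hasDM (hasD_cst (s i j) p v) A2) => [q|]; rewrite mxE ImZ //.
by rewrite mul0r add0r.
Qed.

Lemma rr_escale X : rr X = escale (fun i j => 2^-1 * ((i < j)%N%:R - (j < i)%N%:R)) X.
Proof.
apply/matrixP => i j; rewrite rr_entry mxE /sgr.
by rewrite rmorphM rmorphB !rmorph_nat fmorphV rmorph_nat.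
Qed.
Lemma rsc_escale t X : rsc t X = escale (fun _ _ => t) X.
Proof. by apply/matrixP => i j; rewrite !mxE. Qed.

Lemma msmooth_rr A : msmooth A -> msmooth (fun q => rr (A q)).
Proof. by move=> sA; under eq_fun do rewrite rr_escale; exact: msmooth_escale. Qed.
Lemma msmooth_rsc t A : msmooth A -> msmooth (fun q => rsc t (A q)).
Proof. by move=> sA; under eq_fun do rewrite rsc_escale; exact: msmooth_escale. Qed.
Lemma mhasD_rr A p v X : mhasD A p v X -> mhasD (fun q => rr (A q)) p v (rr X).
Proof.
by move=> sA; under eq_fun do rewrite rr_escale; rewrite rr_escale; exact: mhasD_escale.
Qed.
Lemma mhasD_rsc t A p v X : mhasD A p v X -> mhasD (fun q => rsc t (A q)) p v (rsc t X).
Proof.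
by move=> sA; under eq_fun do rewrite rsc_escale; rewrite rsc_escale; exact: mhasD_escale.
Qed.

Definition qsmooth xi := psmooth (fun q => (xi q).1) /\ psmooth (fun q => (xi q).2).
Definition qhasD xi p v x :=
  phasD (fun q => (xi q).1) p v x.1 /\ phasD (fun q => (xi q).2) p v x.2.

Lemma qsmooth_rho xi : qsmooth xi -> qsmooth (fun q => rho (xi q)).
Proof.
move=> [[s1 s1'] [s2 s2']].
have h A : msmooth A -> msmooth (fun q => rr (A q)) /\ msmooth (fun q => rsc 2^-1 (A q)).
  by move=> sA; split; [exact: msmooth_rr|exact: msmooth_rsc].
have [r1 t1] := h _ s1; have [r1' _] := h _ s1'.
have [r2 t2] := h _ s2; have [r2' t2'] := h _ s2'.
split; split.
- apply: msmoothD (msmoothN r1); apply: msmoothD (msmoothN _); first exact: msmoothD.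
  exact: msmoothD (msmoothN t2).
- exact: r1'.
- apply: msmoothD (msmoothN _); last exact: msmoothD.
  by apply: msmoothD (msmoothN r2); exact: msmoothD.
- apply: msmoothD; last exact: msmoothD (msmoothN t1).
  by apply: msmoothD (msmoothN r2'); exact: msmoothD (msmoothN t2).
Qed.

Lemma qhasD_rho xi p v x : qhasD xi p v x -> qhasD (fun q => rho (xi q)) p v (rho x).
Proof.
move=> [[s1 s1'] [s2 s2']].
have h A X : mhasD A p v X -> mhasD (fun q => rr (A q)) p v (rr X) /\
    mhasD (fun q => rsc 2^-1 (A q)) p v (rsc 2^-1 X).
  by move=> sA; split; [exact: mhasD_rr|exact: mhasD_rsc].
have [r1 t1] := h _ _ s1; have [r1' _] := h _ _ s1'.
have [r2 t2] := h _ _ s2; have [r2' t2'] := h _ _ s2'.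
split; split.
- apply: mhasDD (mhasDN r1); apply: mhasDD (mhasDN _); first exact: mhasDD.
  exact: mhasDD (mhasDN t2).
- exact: r1'.
- apply: mhasDD (mhasDN _); last exact: mhasDD.
  by apply: mhasDD (mhasDN r2); exact: mhasDD.
- apply: mhasDD; last exact: mhasDD (mhasDN t1).
  by apply: mhasDD (mhasDN r2'); exact: mhasDD (mhasDN t2).
Qed.

Lemma smooth_qip xi eta : qsmooth xi -> qsmooth eta -> smooth (fun q => qip (xi q) (eta q)).
Proof.
move=> [[a1 a2] [a3 a4]] [[b1 b2] [b3 b4]].
by apply: smoothD; apply: smoothD; exact: smooth_ip.
Qed.

Lemma hasD_qip xi eta p v x y : qhasD xi p v x -> qhasD eta p v y ->
  hasD (fun q => qip (xi q) (eta q)) p v (qip x (eta p) + qip (xi p) y).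
Proof.
move=> [[a1 a2] [a3 a4]] [[b1 b2] [b3 b4]].
apply: hasD_eq (hasDD (hasDD (hasD_ip a1 b1) (hasD_ip a2 b2))
  (hasDD (hasD_ip a3 b3) (hasD_ip a4 b4))) _.
by rewrite /qip /pip; move: (@ip R n) => f; lra.
Qed.

(** Antisymmetry of [rho] transports additivity from the first argument to the second. *)
Lemma qip_rhoD x x1 x2 y y1 y2 :
  qip (x1 + x2) (rho y) + qip x (rho (y1 + y2))
  = qip x1 (rho y) + qip x (rho y1) + (qip x2 (rho y) + qip x (rho y2)).
Proof.
have qD (u v w : Pt * Pt) : qip (u + v) w = qip u w + qip v w.
  by rewrite /qip /= !pipDl; move: (@pip R n) => f; lra.
rewrite (rho_anti x (y1 + y2)) (rho_anti x y1) (rho_anti x y2) !qD.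
by move: (@qip R n) => f; lra.
Qed.

(* The four components are nabla_1, nabla_1', nabla_2 and nabla_2' of a function with
   gradient a at p. *)
Definition nablas p a : Pt * Pt :=
  ((p.1 *m a.1, a.1 *m p.1), (p.2 *m a.2, a.2 *m p.2)).

(** The infinitesimal action of gl(n,C)^4 by left and right multiplication on g and J; it is the
    transpose of [nablas p]. *)
Definition act x p : Pt :=
  (x.1.1 *m p.1 + p.1 *m x.1.2, x.2.1 *m p.2 + p.2 *m x.2.2).

Lemma qip_nablas p a x : qip (nablas p a) x = pip a (act x p).
Proof.
rewrite /qip /pip /= !ipDr (ip_mulr p.1) (ip_mulr p.2) (ip_mull a.1) (ip_mull a.2).
by [].
Qed.

(** Left and right multiplications commute, and right multiplications compose in reverse order,
    whence the signs in [qcomm]. *)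
Lemma act_comm x y p : act x (act y p) - act y (act x p) = act (qcomm x y) p.
Proof.
have E (X X' Y Y' g : Mat) : X *m (Y *m g + g *m Y') + (Y *m g + g *m Y') *m X'
    - (Y *m (X *m g + g *m X') + (X *m g + g *m X') *m Y')
    = comm X Y *m g + g *m (- comm X' Y').
  rewrite /comm !(mulmxDl, mulmxDr, mulmxN, mulNmx) !mulmxA.
  by apply/matrixP => i j; rewrite !mxE; ring.
have pB (X X' Y Y' : Mat) : ((X, X') : Pt) - (Y, Y') = (X - Y, X' - Y') by [].
by rewrite /act pB !E.
Qed.

Definition Pi2 p a b : R := qip (nablas p a) (rho (nablas p b)).
Definition V2 p b : Pt := act (rho (nablas p b)) p.
(** The product rule for [Pi2] at fixed covectors, [nablas] being linear in the point. *)
Definition DPi2 p v a b : R :=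
  qip (nablas v a) (rho (nablas p b)) + qip (nablas p a) (rho (nablas v b)).

Lemma pipBr a v w : pip a (v - w) = pip a v - pip a w.
Proof.
rewrite /pip; have -> : (v - w).1 = v.1 - w.1 by [].
have -> : (v - w).2 = v.2 - w.2 by [].
by rewrite !ipDr !ipNr; move: (@ip R n) => f; lra.
Qed.

(** Both sides are traces of the same cyclic words; this is why left and right translation
    derivatives contribute equally. *)
Lemma tri_conj X Y Z g : tri (X *m g) (Y *m g) (Z *m g) = tri (g *m X) (g *m Y) (g *m Z).
Proof. by rewrite !triE !(ip_mull X) !(ip_mulr g X) !mulmxA. Qed.

Lemma Pi2_cyclic p a b c :
  DPi2 p (V2 p a) b c + DPi2 p (V2 p b) c a + DPi2 p (V2 p c) a b = 0.
Proof.
(* Regroups six iterated actions by the covector they are paired with: [u], [v], [w] belong to [a],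
   [b], [c], and their differences are the commutator terms. *)
have lin (d1 d2 d3 q1 q2 q3 u1 u2 v1 v2 w1 w2 : R) : q1 + q2 + q3 = 0 ->
    u1 - u2 = q1 -> v1 - v2 = q2 -> w1 - w2 = q3 ->
    d1 = v1 - w2 -> d2 = w1 - u2 -> d3 = u1 - v2 -> d1 + d2 + d3 = 0 by lra.
pose r a := rho (nablas p a).
have E u v w : DPi2 p (V2 p u) v w
    = pip v (act (r w) (act (r u) p)) - pip w (act (r v) (act (r u) p)).
  by rewrite /DPi2 [X in _ + X]rho_anti !qip_nablas.
have S u v w : pip u (act (r v) (act (r w) p)) - pip u (act (r w) (act (r v) p))
    = qip (nablas p u) (qcomm (r v) (r w)).
  by rewrite -pipBr act_comm -qip_nablas.
have e : qip (nablas p a) (qcomm (r b) (r c)) + qip (nablas p b) (qcomm (r c) (r a))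
    + qip (nablas p c) (qcomm (r a) (r b)) = 0.
  rewrite schouten_rho.
  rewrite [(nablas p a).1.2]/= [(nablas p b).1.2]/= [(nablas p c).1.2]/=.
  (* The two cubic forms coming from g cancel, and so do the two from J. *)
  by rewrite tri_conj subrr add0r tri_conj subrr mulr0.
exact: (lin _ _ _ _ _ _ _ _ _ _ _ _ e (S a b c) (S b c a) (S c a b)
  (E a b c) (E b c a) (E c a b)).
Qed.

Lemma bracket2E F H p : smooth F -> smooth H -> inM p ->
  bracket2 F H p = Pi2 p (grad F p) (grad H p).
Proof.
move=> sF sH pM; rewrite /bracket2 /nabla2 /nabla2'.
have d2E K : d2 K p = (grad K p).2 by [].
rewrite !d2E {d2E}.
rewrite (nabla1E sF pM) (nabla1E sH pM) (nabla1'E sF pM) (nabla1'E sH pM).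
move: (grad F p) (grad H p) => a b.
(* This equality absorbs the half multiples of the identity by which [rplus] and [rminus] differ
   from [rr] on the diagonal of the nabla_2 block. *)
have e : ip (p.2 *m a.2) (p.2 *m b.2) = ip (a.2 *m p.2) (b.2 *m p.2).
  by rewrite (ip_mulr p.2) (ip_mull a.2) mulmxA.
rewrite /Pi2 /nablas /rho /qip /pip /=.
move: (p.1 *m a.1) (a.1 *m p.1) (p.2 *m a.2) (a.2 *m p.2) e => x1 x1' x2 x2'.
move: (p.1 *m b.1) (b.1 *m p.1) (p.2 *m b.2) (b.2 *m p.2) => y1 y1' y2 y2' e.
have E (A B : Mat) : ip (rr A) B = - ip A (rr B) by rewrite rr_anti.
have E' (A : Mat) : ip y1 (rr A) = - ip A (rr y1) by rewrite ipC E.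
rewrite /rplus /rminus; move: (@rr R n) E E' => r E E'.
rewrite !E !ipDl !ipDr !ipNl !ipNr !ipDr !ipNr !ipZr.
rewrite !E' ![ip y1 _]ipC.
move: (@ip R n) e => f e; lra.
Qed.

Lemma bracket2_poisson : poisson_bracket (@bracket2 R n).
Proof.
apply: (poisson_criterion (Pi := Pi2) (V := V2) (DPi := DPi2)).
- by move=> F H sF sH p pM; exact: bracket2E.
- by move=> p a b; exact: qip_nablas.
- by move=> p a b; exact: rho_anti.
- move=> al be sa sb.
  have s al' : psmooth al' -> qsmooth (fun q => nablas q (al' q)).
    move=> [a1 a2]; have g := @msmooth_fst R n; have J := @msmooth_snd R n.
    by split; split; exact: msmoothM.
  exact: smooth_qip (s _ sa) (qsmooth_rho (s _ sb)).
- move=> al be p v a b sa sb.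
  have s al' a' : phasD al' p v a' ->
      qhasD (fun q => nablas q (al' q)) p v (nablas v (al' p) + nablas p a').
    move=> [a1 a2]; have g := mhasD_fst p v; have J := mhasD_snd p v.
    split; split; [exact: mhasDM g a1| |exact: mhasDM J a2|].
      by have := mhasDM a1 g; rewrite addrC.
    by have := mhasDM a2 J; rewrite addrC.
  apply: hasD_eq (hasD_qip (s _ _ sa) (qhasD_rho (s _ _ sb))) _.
  exact: qip_rhoD.
- exact: Pi2_cyclic.
Qed.
End Quadratic.

Theorem theorem2p1 (R : realType) (n : nat) :
  poisson_bracket (@bracket1 R n) /\ poisson_bracket (@bracket2 R n).
Proof. by split; [exact: bracket1_poisson|exact: bracket2_poisson]. Qed.
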